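(* Fix $\beta \in \mathbb{R}_{>0}$, and let $\omega$ be the random permutation of $\{1,\dots,N\}$ distributed according to the Mallows measure $\mathcal{M}_{N}^{q}$ with $q=1-\beta/N$, $N \in \mathbb{N}$. Then for any $0 < x, y <1$ and $-\infty <a<b<+\infty$, $$\lim_{N\to\infty}\mathcal{M}_{N}^{q}\left(a < \frac{H_{\lfloor xN\rfloor,\lfloor yN\rfloor}(\omega)-h_{\beta}(x, y) N}{\sigma_{N, \beta}(x,y)}<b\right)=\int_{a}^{b}\mathcal{N}(\alpha)\,d\alpha.$$
   Context: For $q\in[0,1)$, the Mallows measure $\mathcal{M}_N^q$ on permutations of $\{1,\dots,N\}$ assigns to a permutation $w$ the probability $q^{\mathrm{inv}(w)}Y_N$, where $\mathrm{inv}(w)$ is the number of inversions of $w$ and $Y_N=\prod_{j=1}^N\frac{1-q}{1-q^j}$. With $q=1-\beta/N$ one considers $N$ large enough that $q\in[0,1)$. The height function of a permutation $\omega$ of size $N$ is $H_{L,K}(\omega) := \#\{ i : 1 \le i \le L,\ 1 \le \omega(i) \le K \}$, for integers $1\le L,K\le N$. $\mathcal{N}(t)=\frac{1}{\sqrt{2\pi}}e^{-t^2/2}$ is the density of the standard normal distribution. For $\beta>0$, $x,y\in(0,1)$: $$h_{\beta}(x, y)=\frac{1}{\beta}\left[\ln(1-e^{-\beta})-\ln(e^{-\beta x}+e^{-\beta y}-e^{-\beta(x+y)}-e^{-\beta})\right],$$ $$d_{\beta}(x,y)=\tfrac{1}{2}\ln(1- e^{-\beta})-\tfrac{1}{2}\ln(1-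 e^{- \beta(x-h_{\beta}(x, y))})-\tfrac{1}{2}\ln(1- e^{-\beta(y-h_{\beta}(x, y)) }),$$ $$\sigma_{N, \beta}(x,y)=\frac{\sqrt{N}}{\sqrt{\beta}\exp(d_{\beta}(x,y))}.$$ *)

(* Defs.v *)
From HB Require Import structures.
From mathcomp Require Import all_boot all_order all_algebra all_fingroup.
From mathcomp Require Import all_classical all_reals all_analysis.

Set Implicit Arguments.
Unset Strict Implicit.
Unset Printing Implicit Defensive.

Import Order.TTheory GRing.Theory Num.Theory.
Import numFieldNormedType.Exports.

Local Open Scope ring_scope.

(* Permutations of {1, ..., N} are elements of 'S_N, acting on the 0-based
   index type 'I_N; hence "1 <= i <= L" is rendered as "i < L" below. *)

Definition inversions (N : nat) (w : 'S_N) : nat :=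
  #|[pred p : 'I_N * 'I_N | (p.1 < p.2)%N && (w p.2 < w p.1)%N]|.

Definition height (N L K : nat) (w : 'S_N) : nat :=
  #|[pred i : 'I_N | (i < L)%N && (w i < K)%N]|.

Section Mallows.
Context {R : realType}.
Implicit Types (q beta x y : R) (N : nat).

Definition mallows_norm q N : R :=
  \prod_(1 <= j < N.+1) ((1 - q) / (1 - q ^+ j)).

(* These are the point masses of a probability law only when 0 <= q < 1. *)
Definition mallows_pmf q N (w : 'S_N) : R :=
  q ^+ inversions w * mallows_norm q N.

Definition mallows q N (E : pred 'S_N) : R :=
  \sum_(w : 'S_N | E w) mallows_pmf q w.

Definition h_lim beta x y : R :=
  beta^-1 * (ln (1 - expR (- beta))
             - ln (expR (- beta * x) + expR (- beta * y)
                   - expR (- beta * (x + y)) - expR (- beta))).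

Definition d_lim beta x y : R :=
  2^-1 * ln (1 - expR (- beta))
  - 2^-1 * ln (1 - expR (- beta * (x - h_lim beta x y)))
  - 2^-1 * ln (1 - expR (- beta * (y - h_lim beta x y))).

Definition sigma N beta x y : R :=
  Num.sqrt N%:R / (Num.sqrt beta * expR (d_lim beta x y)).

End Mallows.

(* Main.v *)
Require Import Defs.
From HB Require Import structures.
From mathcomp Require Import all_boot all_order all_algebra all_fingroup.
From mathcomp Require Import all_classical all_reals all_analysis.
From mathcomp Require Import zify ring lra.

Set Implicit Arguments.
Unset Strict Implicit.
Unset Printing Implicit Defensive.

Import Order.TTheory GRing.Theory Num.Theory.
Import numFieldNormedType.Exports.

Local Open Scope classical_set_scope.
Local Open Scope ring_scope.

(** Under the Mallows measure the height at $(L, K)$ has a $q$-hypergeometric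
    law: writing $k$ for its value, $B = K - k$, $C = L - k$ and
    $D = N - K - L + k$,
    $$P(k) = \frac{[K]!\,[N-K]!\,[L]!\,[N-L]!}{[N]!\,[k]!\,[B]!\,[C]!\,[D]!}
      \; q^{BC},$$
    with $q$-factorials throughout. This is [inv_gen_qfact], proved by removing
    the last letter of the permutation, which splits the generating polynomial
    of inversions according to whether that letter is at most $K$
    ([inv_genS]).

    No asymptotics of factorials are needed: only the ratio
    $$\frac{P(k+1)}{P(k)} =
      \frac{[K-k]\,[L-k]}{[k+1]\,[D+1]}\; q^{-(K+L-2k-1)}$$
    enters. It decreases in $k$, so $P$ is log-concave
    ([inv_gen_log_concave]). With $q = e^{-\lambda}$, $\lambda \approx
    \beta/N$, its logarithm is a combination of values of
    $F(u) = \ln(1 - e^{-u})$. At $k = hN$ it vanishes to leading order exactly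
    because $h = h_\beta(x,y)$ ([ln1mexp_balance]), and its slope there is
    $-1/\sigma_{N,\beta}^2$ ([dln1mexp_balance]). Hence, with
    $t_k = (k - hN)/\sigma$,
    $$\ln\frac{P(k+1)}{P(k)} = -\frac{t_k}{\sigma} + o(N^{-1/2})$$
    uniformly for bounded $t_k$ ([mallows_gaussian_ratios]).

    The rest holds for any family of distributions with such ratios. Summing
    the ratios, $P(k) e^{t_k^2/2}$ is asymptotically constant on bounded
    windows, so the mass of a window, divided by an amplitude $A_N$ that does
    not depend on the window, tends to its Gaussian mass ([window_cvg]).
    Log-concavity bounds the mass beyond $\pm T$ by roughly $e^{-T^2/2}$
    ([near_tail]); since the total mass is $1$ on both sides, $A_N \to 1$
    ([amplitude_cvg1]) and the limit theorem follows
    ([window_gauss_cvg]). *)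

(** * Inversions and heights *)

(** A permutation of $N+1$ points is determined by the image $v$ of the last
    point and the pattern of the other images. *)
Lemma lift_perm_max_bij N :
  bijective (fun p : 'I_N.+1 * 'S_N => lift_perm ord_max p.1 p.2).
Proof.
apply: inj_card_bij; last by rewrite card_prod card_ord !card_Sn factS.
move=> [v s] [v' s'] /= e.
have ev : v = v' by rewrite -(lift_perm_id ord_max v s) e lift_perm_id.
subst v'; congr pair; apply/permP => i.
by apply: (@lift_inj _ v); rewrite -!(lift_perm_lift ord_max) e.
Qed.

Lemma lift_maxE N (i : 'I_N) : lift ord_max i = i :> nat.
Proof. by rewrite /= /bump leqNgt ltn_ord add0n. Qed.

Lemma height_lift_perm N L K (v : 'I_N.+1) (s : 'S_N) : (L <= N)%N ->
  height L K (lift_perm ord_max v s) =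
  if (v < K)%N then height L K.-1 s else height L K s.
Proof.
move=> LN.
have -> : height L K (lift_perm ord_max v s) =
    #|[pred i : 'I_N | (i < L)%N && (lift v (s i) < K)%N]|.
  rewrite /height -!sum1_card big_mkcond big_ord_recr /= [X in (_ + X)%N]ifF.
    rewrite addn0 [RHS]big_mkcond /=; apply: eq_bigr => i _.
    have -> : widen_ord (leqnSn N) i = lift ord_max i.
      by apply: val_inj; rewrite [RHS]lift_maxE.
    by rewrite !inE lift_perm_lift lift_maxE.
  by rewrite !inE /= ltnNge LN.
rewrite /height.
case: ifPn => vK; apply: eq_card => i; rewrite !inE /= /bump; lia.
Qed.

(** A last letter $v$ forms an inversion with each of the $N - v$ larger
    letters. *)
Lemma inversions_lift_perm N (v : 'I_N.+1) (s : 'S_N) :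
  inversions (lift_perm ord_max v s) = (inversions s + (N - v))%N.
Proof.
rewrite /inversions -!sum1_card.
rewrite big_mkcond /= -(pair_bigA _ (fun i j : 'I_N.+1 =>
  if ((i < j) && (lift_perm ord_max v s j < lift_perm ord_max v s i))%N
  then 1%N else 0%N)) /=.
rewrite [in RHS]big_mkcond /= -(pair_bigA _ (fun i j : 'I_N =>
  if ((i < j) && (s j < s i))%N then 1%N else 0%N)) /=.
have w (i : 'I_N) : widen_ord (leqnSn N) i = lift ord_max i.
  by apply: val_inj; rewrite [RHS]lift_maxE.
rewrite big_ord_recr /= [X in (_ + X)%N]big1 ?addn0; last first.
  by move=> j _; rewrite ifF //; apply/negbTE; rewrite negb_and -leqNgt leq_ord.
have e1 (i : 'I_N) : (\sum_(j < N.+1) (if ((widen_ord (leqnSn N) i < j) &&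
      (lift_perm ord_max v s j < lift_perm ord_max v s (widen_ord (leqnSn N) i)))%N then 1 else 0) =
    \sum_(j < N) (if ((i < j) && (s j < s i))%N then 1 else 0) + (v <= s i))%N.
  rewrite big_ord_recr; congr addn.
    apply: eq_bigr => j _; rewrite !w !lift_perm_lift !lift_maxE /= /bump.
    by congr (if _ then _ else _); lia.
  rewrite /= w lift_perm_lift lift_perm_id ltn_ord /= /bump; case: leqP; lia.
rewrite (eq_bigr _ (fun i _ => e1 i)) big_split /=; congr addn.
rewrite (reindex_inj (@perm_inj _ s^-1%g)) /=.
under eq_bigr do rewrite permKV.
rewrite -(big_mkord xpredT (fun i => nat_of_bool (v <= i)%N)) 
  (@big_cat_nat _ _ _ v) //=; last by rewrite -ltnS.
rewrite big_nat big1 ?add0n; last by move=> i /andP[_ iv]; rewrite leqNgt iv.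
rewrite big_nat (eq_bigr (fun=> 1%N)); last by move=> i /andP[-> _].
by rewrite -big_nat sum_nat_const_nat muln1.
Qed.

Section QCount.
Variables (R : comNzRingType) (q : R).

(** The $q$-integer $[n]_q = 1 + q + \dots + q^{n-1}$. *)
Definition qint n : R := \sum_(i < n) q ^+ i.

(** The $q$-factorial $[n]_q! = [1]_q \cdots [n]_q$. *)
Definition qfact n : R := \prod_(i < n) qint i.+1.

Lemma qint0 : qint 0 = 0. Proof. by rewrite /qint big_ord0. Qed.

Lemma qintD m n : qint (m + n) = q ^+ n * qint m + qint n.
Proof.
rewrite /qint addnC big_split_ord /= addrC mulr_sumr; congr (_ + _).
by apply: eq_bigr => i _; rewrite exprD.
Qed.

Lemma qfact0 : qfact 0 = 1. Proof. by rewrite /qfact big_ord0. Qed.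

Lemma qfactS n : qfact n.+1 = qint n.+1 * qfact n.
Proof. by rewrite /qfact big_ord_recr mulrC. Qed.

Lemma qint_rev m n : \sum_(i < m) q ^+ (n + m - i.+1) = q ^+ n * qint m.
Proof.
rewrite /qint mulr_sumr (reindex_inj rev_ord_inj) /=; apply: eq_bigr => i _.
by rewrite -exprD; congr (_ ^+ _); have := ltn_ord i; lia.
Qed.

(** Generating polynomial of inversions over the permutations of height $k$
    at $(L, K)$. *)
Definition inv_gen N L K k : R :=
  \sum_(w : 'S_N | height L K w == k) q ^+ inversions w.

Lemma sum_inversions N : \sum_(w : 'S_N) q ^+ inversions w = qfact N.
Proof.
elim: N => [|N IH].
  rewrite qfact0 (eq_bigr (fun=> 1)) => [|w _].
    by rewrite big_const iter_addr_0 card_Sn.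
  by rewrite /inversions eq_card0 // => -[[]].
rewrite (reindex _ (onW_bij _ (lift_perm_max_bij N))) /=.
rewrite -(pair_bigA _ (fun v s => q ^+ inversions (lift_perm ord_max v s))) /=.
under eq_bigr => v _ do under eq_bigr => s _ do
  rewrite inversions_lift_perm exprD.
under eq_bigr => v _ do rewrite -mulr_suml IH.
rewrite -mulr_sumr qfactS mulrC -[qint _]mul1r -(expr0 q) -qint_rev.
by congr (_ * _); apply: eq_bigr => i _; rewrite add0n subSS.
Qed.

(** Splitting off the last letter, which is either among the $K$ smallest or
    not. *)
Lemma inv_genS N L K k : (L <= N)%N -> (K <= N.+1)%N ->
  inv_gen N.+1 L K k =
    q ^+ (N.+1 - K) * qint K * inv_gen N L K.-1 k
    + qint (N.+1 - K) * inv_gen N L K k.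
Proof.
move=> LN KN; rewrite /inv_gen.
rewrite (reindex _ (onW_bij _ (lift_perm_max_bij N))) /=.
rewrite -(pair_big_dep xpredT (fun v s => height L K (lift_perm ord_max v s) == k)
  (fun v s => q ^+ inversions (lift_perm ord_max v s))) /=.
have e (v : 'I_N.+1) : \sum_(s | height L K (lift_perm ord_max v s) == k)
     q ^+ inversions (lift_perm ord_max v s) =
   q ^+ (N - v) * inv_gen N L (if (v < K)%N then K.-1 else K) k.
  rewrite /inv_gen mulr_sumr; apply: eq_big => [s|s _].
    by rewrite height_lift_perm //; case: ifP.
  by rewrite inversions_lift_perm exprD mulrC.
rewrite (eq_bigr _ (fun v _ => e v)).
rewrite -(big_mkord xpredT (fun v => q ^+ (N - v) * inv_gen N L (if (v < K)%N then K.-1 else K) k)).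
rewrite (@big_cat_nat _ _ _ K) //=; congr (_ + _).
  rewrite -qint_rev mulr_suml big_mkord; apply: eq_bigr => i _.
  by rewrite ltn_ord /inv_gen; congr (q ^+ _ * _); lia.
rewrite -{1}[K in \sum_(K <= _ < _) _]add0n big_addn
  -[qint _]mul1r -(expr0 q) -qint_rev mulr_suml big_mkord.
apply: eq_bigr => i _; rewrite ltnNge leq_addl /= /inv_gen.
by congr (q ^+ _ * _); lia.
Qed.


End QCount.

Lemma card_ltn_ord N K : #|[pred i : 'I_N | (i < K)%N]| = minn N K.
Proof.
rewrite -sum1_card big_mkcond /=; elim: N => [|N IH].
  by rewrite big_ord0 min0n.
by rewrite big_ord_recr /= {}IH inE /=; case: ltnP; lia.
Qed.

Lemma height_leL N L K (w : 'S_N) : (height L K w <= L)%N.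
Proof.
apply: leq_trans (geq_minr N L); rewrite -card_ltn_ord.
by apply/subset_leq_card/fintype.subsetP => i; rewrite !inE => /andP[].
Qed.

Lemma height_leK N L K (w : 'S_N) : (height L K w <= K)%N.
Proof.
apply: leq_trans (geq_minr N K); rewrite -card_ltn_ord.
rewrite /height -(fintype.card_image (@perm_inj _ w) [pred i : 'I_N | (i < L)%N && (w i < K)%N]).
apply/subset_leq_card/fintype.subsetP => j /fintype.imageP[i].
by rewrite !inE => /andP[_ iK] ->.
Qed.

Lemma height_ge N L K (w : 'S_N) : (L <= N)%N -> (K <= N)%N ->
  (L + K <= N + height L K w)%N.
Proof.
move=> LN KN.
have eK : #|[pred i : 'I_N | (w i < K)%N]| = K.
  rewrite -[RHS](minn_idPr KN) -card_ltn_ord -[LHS](fintype.card_image (@perm_inj _ w)).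
  apply: eq_card => j; rewrite !inE; apply/fintype.imageP/idP => [[i]|jK].
    by rewrite inE => iK ->.
  by exists ((w^-1)%g j); rewrite ?inE permKV.
have eL : #|[pred i : 'I_N | (i < L)%N]| = L by rewrite card_ltn_ord; lia.
have := cardUI [pred i : 'I_N | (i < L)%N] [pred i : 'I_N | (w i < K)%N].
rewrite eK eL => <-; apply: leq_add.
  by rewrite -[X in (_ <= X)%N](card_ord N) max_card.
by apply/subset_leq_card/fintype.subsetP => i; rewrite !inE.
Qed.

Section QCount2.
Variables (R : comNzRingType) (q : R).

Lemma inv_gen_eq0 N L K k : (L <= N)%N -> (K <= N)%N ->
  ~~ [&& (L + K <= N + k)%N, (k <= K)%N & (k <= L)%N] -> inv_gen q N L K k = 0.
Proof.
move=> LN KN nk; rewrite /inv_gen big_pred0 // => w; apply/negbTE.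
apply: contra nk => /eqP <-.
by rewrite height_ge // height_leK height_leL.
Qed.

(** The $q$-hypergeometric law, in terms of the numbers $A$, $B$, $C$, $D$ of
    points in the four blocks cut out by $i \le L$ and $\omega(i) \le K$.
    Induction on $B + D = N - L$, the number of positions beyond $L$. *)
Lemma inv_gen_qfact A B C D :
  inv_gen q (A + B + C + D) (A + C) (A + B) A
    * (qfact q A * qfact q B * qfact q C * qfact q D) =
  qfact q (A + B) * qfact q (C + D) * qfact q (A + C) * qfact q (B + D)
    * q ^+ (B * C).
Proof.
have [n] := ubnP (B + D); elim: n A B C D => // n IH A B C D ltn.
have [/eqP|BD0] := eqVneq (B + D)%N 0%N.
  rewrite addn_eq0 => /andP[/eqP-> /eqP->].
  rewrite !addn0 mul0n expr0 mulr1 qfact0 !mulr1.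
  rewrite -(sum_inversions q (A + C)) /inv_gen.
  rewrite (eq_bigl xpredT); first by ring.
  move=> w /=; apply/eqP.
  have := height_leK (A + C) A w.
  by have := height_ge w (leqnn (A + C)) (leq_addr C A); lia.
have [M eM] : exists M, (A + B + C + D = M.+1)%N by exists (A + B + C + D).-1; lia.
rewrite eM inv_genS; [|lia|lia].
have -> : (M.+1 - (A + B) = C + D)%N by lia.
(* For B = 0 both sides vanish: with A - 1 small letters left the height cannot
   be A, and for A = 0 there is no small letter to remove. *)
have e1 : qint q (A + B) * inv_gen q M (A + C) (A + B).-1 A
    * (qfact q A * qfact q B * qfact q C * qfact q D) =
    qfact q (A + B) * qfact q (C + D) * qfact q (A + C) * qfact q (B + D).-1
      * (q ^+ (B.-1 * C)) * qint q B.
  case: B eM ltn BD0 => [|B] eM ltn BD0.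
    rewrite qint0 mulr0; case: A eM => [|A] eM; first by rewrite qint0 !mul0r.
    rewrite inv_gen_eq0 ?mulr0 ?mul0r //; lia.
  have -> : M = (A + B + C + D)%N by lia.
  have -> : (A + B.+1).-1 = (A + B)%N by lia.
  have -> : (B.+1 + D).-1 = (B + D)%N by lia.
  rewrite (addnS A B) !qfactS /=.
  have := IH A B C D; move=> /(_ ltac:(lia)) H.
  transitivity (qint q (A + B).+1 * qint q B.+1 *
    (inv_gen q (A + B + C + D) (A + C) (A + B) A
      * (qfact q A * qfact q B * qfact q C * qfact q D))).
    by ring.
  by rewrite H; ring.
(* For D = 0 both sides vanish: with A + B + C - 1 letters the height is at
   least A + 1, and for C = 0 there is no large letter to remove. *)
have e2 : qint q (C + D) * inv_gen q M (A + C) (A + B) A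
    * (qfact q A * qfact q B * qfact q C * qfact q D) =
    qfact q (A + B) * qfact q (C + D) * qfact q (A + C) * qfact q (B + D).-1
      * (q ^+ (B * C)) * qint q D.
  case: D eM ltn BD0 {e1} => [|D] eM ltn BD0.
    rewrite qint0 mulr0; case: C eM => [|C] eM; first by rewrite qint0 !mul0r.
    rewrite inv_gen_eq0 ?mulr0 ?mul0r //; lia.
  have -> : M = (A + B + C + D)%N by lia.
  have -> : (B + D.+1).-1 = (B + D)%N by lia.
  rewrite (addnS C D) !qfactS /=.
  have := IH A B C D; move=> /(_ ltac:(lia)) H.
  transitivity (qint q (C + D).+1 * qint q D.+1 *
    (inv_gen q (A + B + C + D) (A + C) (A + B) A
      * (qfact q A * qfact q B * qfact q C * qfact q D))).
    by ring.
  by rewrite H; ring.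
have e3 : qfact q (B + D) = qint q (B + D) * qfact q (B + D).-1.
  by rewrite -[in LHS](prednK (n := B + D)) ?lt0n // qfactS prednK ?lt0n.
transitivity (q ^+ (C + D) * (qint q (A + B) * inv_gen q M (A + C) (A + B).-1 A
    * (qfact q A * qfact q B * qfact q C * qfact q D)) +
  qint q (C + D) * inv_gen q M (A + C) (A + B) A
    * (qfact q A * qfact q B * qfact q C * qfact q D)); first by ring.
rewrite e1 e2 e3 qintD.
have e4 : q ^+ (C + D) * (q ^+ (B.-1 * C) * qint q B) = q ^+ (B * C) * q ^+ D * qint q B.
  case: (B) => [|b]; first by rewrite qint0 !mulr0.
  by rewrite /= mulSn !exprD; ring.
transitivity (qfact q (A + B) * qfact q (C + D) * qfact q (A + C) *
   qfact q (B + D).-1 * (q ^+ (C + D) * (q ^+ (B.-1 * C) * qint q B))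
   + qfact q (A + B) * qfact q (C + D) * qfact q (A + C) *
   qfact q (B + D).-1 * (q ^+ (B * C) * qint q D)); first by ring.
by rewrite e4; ring.
Qed.
End QCount2.

(** * Law of the height *)

Section HeightLaw.
Variables (R : realFieldType) (q : R).
Hypotheses (q0 : 0 < q) (q1 : q < 1).

Lemma qint_le m n : (m <= n)%N -> qint q m <= qint q n.
Proof.
move=> /subnKC <-; rewrite addnC qintD lerDr mulr_ge0 ?exprn_ge0 ?(ltW q0) //.
by rewrite sumr_ge0 // => i _; rewrite exprn_ge0 ?(ltW q0).
Qed.

Lemma qint_gt0 n : (0 < n)%N -> 0 < qint q n.
Proof.
move=> /qint_le; apply: lt_le_trans.
by rewrite /qint big_ord_recl big_ord0 addr0 expr0 ltr01.
Qed.

Lemma qint_ge0 n : 0 <= qint q n.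
Proof. by rewrite -(qint0 q) qint_le. Qed.

Lemma qfact_gt0 n : 0 < qfact q n.
Proof. by rewrite prodr_gt0 // => i _; exact: qint_gt0. Qed.

Lemma qintE n : qint q n = (1 - q ^+ n) / (1 - q).
Proof.
rewrite -[1 - q ^+ n]opprB subrX1 -mulNr opprB mulrC mulKf //.
by rewrite gt_eqF // subr_gt0.
Qed.

Lemma inv_gen_gt0 N L K k : (L <= N)%N -> (K <= N)%N ->
  (L + K <= N + k)%N -> (k <= K)%N -> (k <= L)%N -> 0 < inv_gen q N L K k.
Proof.
move=> LN KN LK kK kL.
have := inv_gen_qfact q k (K - k) (L - k) (N + k - (L + K)).
have -> : (k + (K - k) + (L - k) + (N + k - (L + K)) = N)%N by lia.
rewrite !subnKC // => e.
rewrite -(@pmulr_lgt0 _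
  (qfact q k * qfact q (K - k) * qfact q (L - k) * qfact q (N + k - (L + K)))).
  by rewrite e !mulr_gt0 ?qfact_gt0 ?exprn_gt0.
by rewrite !mulr_gt0 ?qfact_gt0.
Qed.

Lemma inv_gen_ge0 N L K k : 0 <= inv_gen q N L K k.
Proof. by apply: sumr_ge0 => w _; rewrite exprn_ge0 // ltW. Qed.

(** The number $N + (k+1) - (L + K)$ is the size $D + 1$ of the fourth block, and
    $K + L - (2k + 1)$ is the drop in the exponent $BC$. *)
Lemma inv_gen_ratio N L K k : (L <= N)%N -> (K <= N)%N ->
  (L + K <= N + k)%N -> (k < K)%N -> (k < L)%N ->
  inv_gen q N L K k.+1 * (qint q k.+1 * qint q (N + k.+1 - (L + K)) * q ^+ (K + L - (k + k.+1)))
  = inv_gen q N L K k * (qint q (K - k) * qint q (L - k)).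
Proof.
move=> LN KN LK kK kL.
have [B eB] : exists B, K = (k + B.+1)%N by exists (K - k.+1)%N; lia.
have [C eC] : exists C, L = (k + C.+1)%N by exists (L - k.+1)%N; lia.
have [D eD] : exists D, N = (k + B.+1 + C.+1 + D)%N by exists (N - (k + B.+1 + C.+1))%N; lia.
have -> : (N + k.+1 - (L + K) = D.+1)%N by lia.
have -> : (K + L - (k + k.+1) = (B + C).+1)%N by lia.
have -> : (K - k = B.+1)%N by lia.
have -> : (L - k = C.+1)%N by lia.
have e1 := inv_gen_qfact q k B.+1 C.+1 D.
have e2 := inv_gen_qfact q k.+1 B C D.+1.
rewrite -eD -eB -eC in e1.
have e3 : (k.+1 + B = K)%N by lia.
have e4 : (k.+1 + C = L)%N by lia.
have e5 : (k.+1 + B + C + D.+1 = N)%N by lia.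
have e6 : (C + D.+1 = C.+1 + D)%N by lia.
have e7 : (B + D.+1 = B.+1 + D)%N by lia.
rewrite e5 e4 e3 e6 e7 in e2.
have F0 : qfact q k * qfact q B * qfact q C * qfact q D != 0.
  by rewrite gt_eqF // !mulr_gt0 ?qfact_gt0.
apply: (mulIf F0).
rewrite !qfactS in e1 e2.
transitivity (inv_gen q N L K k.+1 *
  (qint q k.+1 * qfact q k * qfact q B * qfact q C * (qint q D.+1 * qfact q D)) * q ^+ (B + C).+1).
  by ring.
rewrite e2.
transitivity (inv_gen q N L K k *
  (qfact q k * (qint q B.+1 * qfact q B) * (qint q C.+1 * qfact q C) * qfact q D)); last by ring.
rewrite e1 -mulrA -exprD; congr (_ * q ^+ _); lia.
Qed.

(** Log-concavity in a four-term form that needs no division, hence covers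
    values outside the support. It holds because the ratio of consecutive
    values decreases. *)
Lemma inv_gen_log_concave (N L K i j m : nat) : (L <= N)%N -> (K <= N)%N -> (i <= j)%N ->
  inv_gen q N L K i * inv_gen q N L K (j + m)%N
    <= inv_gen q N L K (i + m)%N * inv_gen q N L K j.
Proof.
move=> LN KN ij.
have [/and3P[iN _ _]|/(inv_gen_eq0 q LN KN) ->] :=
    boolP [&& L + K <= N + i, i <= K & i <= L]%N; last first.
  by rewrite mul0r mulr_ge0 ?inv_gen_ge0.
have [/and3P[_ jK jL]|/(inv_gen_eq0 q LN KN) ->] :=
    boolP [&& L + K <= N + (j + m), j + m <= K & j + m <= L]%N; last first.
  by rewrite mulr0 mulr_ge0 ?inv_gen_ge0.
elim: m jK jL => [|m IH] jK jL; first by rewrite !addn0.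
have {}IH := IH ltac:(lia) ltac:(lia).
pose num k := qint q (K - k) * qint q (L - k).
pose den k := qint q k.+1 * qint q (N + k.+1 - (L + K)) * q ^+ (K + L - (k + k.+1)).
have rt k : (i <= k)%N -> (k <= j + m)%N ->
    inv_gen q N L K k.+1 * den k = inv_gen q N L K k * num k.
  by move=> ik kjm; apply: inv_gen_ratio => //; lia.
have den0 k : (i <= k)%N -> 0 < den k.
  by move=> ik; rewrite /den !mulr_gt0 ?qint_gt0 ?exprn_gt0 //; lia.
have num_le k l : (k <= l)%N -> num l <= num k.
  by move=> kl; rewrite /num ler_pM ?qint_ge0 // qint_le //; lia.
have den_le k l : (k <= l)%N -> den k <= den l.
  move=> kl; rewrite /den !ler_pM ?mulr_ge0 ?qint_ge0 ?exprn_ge0 ?(ltW q0) //.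
  - by rewrite qint_le //; lia.
  - by rewrite qint_le //; lia.
  - by apply: ler_wiXn2l; rewrite ?(ltW q0) ?(ltW q1) //; lia.
have num0 k : 0 <= num k by rewrite /num mulr_ge0 ?qint_ge0.
have di := den0 (i + m)%N (leq_addr _ _); have dj := den0 (j + m)%N ltac:(lia).
rewrite !addnS -(ler_pM2r di) -(ler_pM2r dj).
rewrite -[leLHS]mulrA [den _ * _]mulrC mulrA -[_ * _ * den (j + m)%N]mulrA rt; [|lia|lia].
have -> : inv_gen q N L K (i + m).+1%N * inv_gen q N L K j * den (i + m)%N * den (j + m)%N
   = inv_gen q N L K (i + m).+1%N * den (i + m)%N * (inv_gen q N L K j * den (j + m)%N) by ring.
rewrite rt; [|lia|lia].
have -> : inv_gen q N L K (i + m)%N * num (i + m)%N * (inv_gen q N L K j * den (j + m)%N) =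
  inv_gen q N L K (i + m)%N * inv_gen q N L K j * (num (i + m)%N * den (j + m)%N) by ring.
have -> : inv_gen q N L K i * (inv_gen q N L K (j + m)%N * num (j + m)%N) * den (i + m)%N =
  inv_gen q N L K i * inv_gen q N L K (j + m)%N * (num (j + m)%N * den (i + m)%N) by ring.
have ijm : (i + m <= j + m)%N by rewrite leq_add2r.
apply: ler_pM => //; [by rewrite mulr_ge0 ?inv_gen_ge0|exact: mulr_ge0 (num0 _) (ltW di)|].
by apply: ler_pM; [exact: num0|exact: ltW|exact: num_le|exact: den_le].
Qed.

(** Probability that the height at $(L, K)$ is $k$, under the Mallows measure of
    parameter $q$ (see [mallows_heightE]). *)
Definition height_pmf N L K k : R := inv_gen q N L K k / qfact q N.

Lemma sum_height_pmf N L K (g : pred nat) : (K <= N)%N ->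
  \sum_(k < N.+1 | g k) height_pmf N L K k =
  \sum_(w : 'S_N | g (height L K w)) q ^+ inversions w / qfact q N.
Proof.
move=> KN; have hN (w : 'S_N) : (height L K w < N.+1)%N.
  by rewrite ltnS (leq_trans (height_leK _ _ _)).
rewrite (partition_big (fun w => Ordinal (hN w)) (fun k : 'I_N.+1 => g k)) //=.
apply: eq_bigr => k gk; rewrite /height_pmf /inv_gen mulr_suml.
apply: eq_bigl => w; rewrite -val_eqE /=.
by case: eqVneq => [->|]; rewrite ?gk ?andbF.
Qed.

Lemma sum_height_pmf1 N L K : (K <= N)%N ->
  \sum_(k < N.+1) height_pmf N L K k = 1.
Proof.
move=> KN; rewrite (sum_height_pmf L predT KN) -mulr_suml sum_inversions divff //.
by rewrite gt_eqF // qfact_gt0.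
Qed.

End HeightLaw.

Lemma mallows_heightE (R : realType) (q : R) N L K (g : pred nat) :
  0 < q -> q < 1 -> (K <= N)%N ->
  mallows q [pred w : 'S_N | g (height L K w)] =
  \sum_(k < N.+1 | g k) height_pmf q N L K k.
Proof.
move=> q0 q1 KN; rewrite sum_height_pmf // /mallows /mallows_pmf.
apply: eq_bigr => w _; congr (_ * _).
rewrite /mallows_norm big_add1 /= big_mkord /qfact -prodfV.
by apply: eq_bigr => i _; rewrite qintE // invf_div.
Qed.

(** * Gaussian mass of segments *)

Section GaussInt.
Variable R : realType.
Implicit Types s t u x : R.
Local Notation mu := (@lebesgue_measure R).

(** Standard normal mass of the segment $[s, t]$. *)
Definition gauss_int s t : R := \int[mu]_(x in `[s, t]) normal_pdf 0 1 x.

Lemma std_normal_pdfE x :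
  normal_pdf 0 1 x = normal_peak 1 * expR (- (x ^+ 2 / 2)).
Proof. by rewrite normal_pdfE ?oner_neq0 // /normal_fun subr0 expr1n mulNr. Qed.

Lemma std_normal_peak_le1 : normal_peak 1 <= 1 :> R.
Proof.
rewrite /normal_peak invf_le1; last first.
  by rewrite sqrtr_gt0 expr1n mul1r mulrn_wgt0 // pi_gt0.
rewrite -[leLHS]sqrtr1 ler_sqrt; last by rewrite mulrn_wge0 // expr1n mul1r pi_ge0.
by rewrite expr1n mul1r; have := @pi_ge2 R; lra.
Qed.

Lemma std_normal_pdf_le1 x : normal_pdf 0 1 x <= 1.
Proof.
exact: (le_trans (normal_pdf_ub _ _ (oner_neq0 _)) std_normal_peak_le1).
Qed.

Lemma integrable_itv_normal_pdf s t :
  mu.-integrable `[s, t] (EFin \o normal_pdf 0 1).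
Proof. by apply: (integrableS _ _ (subsetT _)) => //; exact: integrable_normal_pdf. Qed.

Lemma gauss_intD s t u : s <= t -> t <= u ->
  gauss_int s u = gauss_int s t + gauss_int t u.
Proof.
move=> st tu; apply/eqP; rewrite addrC -subr_eq; apply/eqP; rewrite /gauss_int.
rewrite Rintegral_itvB ?bnd_simp//; last exact: integrable_itv_normal_pdf.
rewrite Rintegral_itv_obnd_cbnd //.
apply: integrableS (integrable_itv_normal_pdf t u) => //.
by apply: subset_itvr; rewrite bnd_simp.
Qed.

Let fine_itv s t : s <= t -> fine (mu `[s, t]%classic) = t - s.
Proof.
rewrite lebesgue_measure_itv /= lte_fin le_eqVlt => /predU1P[->|->] //.
by rewrite ltxx subrr.
Qed.

Let integrable_cst s t c : mu.-integrable `[s, t] (EFin \o (fun _ : R => c)).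
Proof.
apply: continuous_compact_integrable; first exact: segment_compact.
by apply: continuous_subspaceT => x; exact: cvg_cst.
Qed.

Lemma gauss_int_ge s t m : s <= t ->
  (forall x, s <= x <= t -> m <= normal_pdf 0 1 x) -> m * (t - s) <= gauss_int s t.
Proof.
move=> st H; rewrite -(fine_itv st) -Rintegral_cst //.
apply: le_Rintegral; [by []|exact: integrable_cst|exact: integrable_itv_normal_pdf|].
by move=> x /=; rewrite in_itv; exact: H.
Qed.

Lemma gauss_int_le s t M : s <= t ->
  (forall x, s <= x <= t -> normal_pdf 0 1 x <= M) -> gauss_int s t <= M * (t - s).
Proof.
move=> st H; rewrite -(fine_itv st) -Rintegral_cst //.
apply: le_Rintegral; [by []|exact: integrable_itv_normal_pdf|exact: integrable_cst|].
by move=> x /=; rewrite in_itv; exact: H.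
Qed.

Lemma gauss_int_ge0 s t : 0 <= gauss_int s t.
Proof. by apply: Rintegral_ge0 => x _; exact: normal_pdf_ge0. Qed.

Lemma gauss_int_le_len s t : s <= t -> gauss_int s t <= t - s.
Proof.
move=> st; rewrite -[leRHS]mul1r; apply: gauss_int_le => // x _.
exact: std_normal_pdf_le1.
Qed.

Lemma gauss_intE s t : gauss_int s t = fine (normal_prob 0 1 `[s, t]%classic).
Proof. by []. Qed.

Lemma gauss_int_le1 s t : gauss_int s t <= 1.
Proof.
rewrite gauss_intE -lee_fin fineK; first exact: probability_le1.
exact: fin_num_measure.
Qed.

(** Continuity of the normal probability along the segments $[-n, n]$. *)
Lemma gauss_int_cvg1 : gauss_int (- n%:R) n%:R @[n --> \oo] --> (1 : R).
Proof.
pose F (n : nat) := (`[- n%:R, n%:R] : set R)%classic.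
have FT : \bigcup_n F n = setT.
  rewrite -subTset => x _; exists (Num.truncn `|x|).+1 => //=.
  by rewrite /F /= in_itv /= -ler_norml ltW // truncnS_gt.
have H : normal_prob 0 1 (F n) @[n --> \oo] --> normal_prob (0 : R) 1 (\bigcup_n F n).
  apply: (@nondecreasing_cvg_mu _ _ _ (normal_prob (0 : R) 1)).
  - by move=> n; exact: measurable_itv.
  - by rewrite FT.
  - move=> m n mn; apply/subsetPset => x; rewrite /F /= !in_itv /= => /andP[mx xm].
    have mn' : m%:R <= n%:R :> R by rewrite ler_nat.
    by apply/andP; split; lra.
rewrite FT {2}/normal_prob integral_normal_pdf in H.
exact: fine_cvg H.
Qed.
End GaussInt.

(** * Local limits from ratios *)

Section LocalLimit.
Variable R : realType.
Implicit Types (x y s e T : R) (N k m n : nat).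

Lemma near_sqrt_ge (M : R) : \forall N \near \oo, M <= Num.sqrt N%:R.
Proof.
near=> N; have [M0|M0] := leP M 0; first by rewrite (le_trans M0) ?sqrtr_ge0.
rewrite -(ger0_norm (ltW M0)) -sqrtr_sqr ler_wsqrtr //.
by apply/ltW/(lt_le_trans (truncnS_gt (M ^+ 2))); rewrite ler_nat; near: N; exact: nbhs_infty_ge.
Unshelve. all: by end_near. Qed.

Variables (h tau : R).
Hypotheses (h0 : 0 < h) (h1 : h < 1) (tau0 : 0 < tau).

(** Lattice spacing after rescaling by the standard deviation
    $\tau\sqrt N$. *)
Definition mesh N : R := (tau * Num.sqrt N%:R)^-1.

(** The integer $k$, centred at $hN$ and rescaled. *)
Definition rescale N k : R := (k%:R - h * N%:R) * mesh N.

Lemma near_mesh e : 0 < e -> \forall N \near \oo, 0 < mesh N <= e.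
Proof.
move=> e0; near=> N.
have sN : (tau * e)^-1 <= Num.sqrt N%:R by near: N; exact: near_sqrt_ge.
have sN0 : 0 < Num.sqrt N%:R :> R by rewrite (lt_le_trans _ sN)// invr_gt0 mulr_gt0.
rewrite /mesh invr_gt0 mulr_gt0 //=.
rewrite -[leRHS]invrK lef_pV2 ?posrE ?invr_gt0 ?mulr_gt0 //.
by rewrite -ler_pdivrMl // -invfM.
Unshelve. all: by end_near. Qed.

Lemma rescaleS N k : rescale N k.+1 = rescale N k + mesh N.
Proof. by rewrite /rescale -natr1; ring. Qed.

Lemma rescaleB N k n : (k <= n)%N ->
  rescale N n = rescale N k + (n - k)%:R * mesh N.
Proof. by move=> kn; rewrite /rescale natrB //; ring. Qed.

Lemma rescale_le N k n : 0 < mesh N -> (rescale N k <= rescale N n) = (k <= n)%N.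
Proof. by move=> d0; rewrite /rescale ler_pM2r // lerD2r ler_nat. Qed.

(** For $N$ large, the real number $X$ that rescales to $s$ satisfies
    $0 \le X \le N - 1$, and comparing integers with $X$ amounts to comparing
    their rescaled values with $s$. *)
Lemma near_cut s : \forall N \near \oo,
  exists X : R, [/\ 0 <= X, X + 1 <= N%:R &
    forall k, ((k%:R <= X) = (rescale N k <= s)) * ((X <= k%:R) = (s <= rescale N k))
     * ((k%:R <= X + 1) = (rescale N k <= s + mesh N))].
Proof.
near=> N.
have d0 : 0 < mesh N by near: N; apply: filterS (near_mesh ltr01) => N /andP[].
exists (h * N%:R + s / mesh N).
have r1 : `|s| * tau / h <= Num.sqrt N%:R by near: N; exact: near_sqrt_ge.
have r2 : (`|s| * tau + 1) / (1 - h) <= Num.sqrt N%:R by near: N; exact: near_sqrt_ge.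
have r3 : 1 <= Num.sqrt N%:R :> R by near: N; exact: near_sqrt_ge.
rewrite ler_pdivrMr // in r1; rewrite ler_pdivrMr ?subr_gt0 // in r2.
have eN : N%:R = Num.sqrt N%:R * Num.sqrt N%:R :> R by rewrite -expr2 sqr_sqrtr.
have eX : h * N%:R + s / mesh N = Num.sqrt N%:R * (h * Num.sqrt N%:R + s * tau).
  by rewrite {1}eN /mesh invrK; ring.
have [s1 s2] : - (`|s| * tau) <= s * tau /\ s * tau <= `|s| * tau.
  by rewrite -mulNr !ler_pM2r // ler_norm; split => //; rewrite lerNl -normrN ler_norm.
split.
- by rewrite eX mulr_ge0 ?sqrtr_ge0 //; lra.
- rewrite eX [leRHS]eN.
  have : Num.sqrt N%:R * 1 <= Num.sqrt N%:R * (Num.sqrt N%:R - (h * Num.sqrt N%:R + s * tau)).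
    by rewrite ler_pM2l; lra.
  lra.
- move=> k; rewrite /rescale -!(ler_pdivlMr _ _ d0) -!(ler_pdivrMr _ _ d0) mulrDl divff ?gt_eqF //.
  by rewrite !lerBlDl !lerBrDl addrA.
Unshelve. all: by end_near. Qed.

(** The first integer whose rescaled value is at least $s$. *)
Lemma near_ge_cut s : \forall N \near \oo, exists n, [/\ (n <= N)%N,
  s <= rescale N n <= s + mesh N & forall k, (n <= k)%N = (s <= rescale N k)].
Proof.
apply: filterS (near_cut s) => N [X [X0 XN H]].
have [n [Xn nX]] : exists n : nat, X <= n%:R /\ n%:R <= X + 1 /\ n%:R < X + 1.
  have /andP[t1 t2] := truncn_itv X0.
  have [e|ne] := eqVneq (Num.truncn X)%:R X; first by exists (Num.truncn X); lra.
  exists (Num.truncn X).+1; split; first by rewrite ltW.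
  suff: (Num.truncn X)%:R < X by rewrite -natr1; lra.
  by rewrite lt_neqAle ne.
exists n; split.
- by rewrite -(ler_nat R) (le_trans _ XN) //; lra.
- by rewrite -!H Xn; apply/andP; split => //; lra.
- move=> k; rewrite -H; apply/idP/idP => [nk|Xk].
    by rewrite (le_trans Xn) // ler_nat.
  rewrite leqNgt; apply/negP => kn.
  have : k.+1%:R <= n%:R :> R by rewrite ler_nat.
  rewrite -natr1; lra.
Qed.

(** The first integer whose rescaled value exceeds $s$. *)
Lemma near_gt_cut s : \forall N \near \oo, exists n, [/\ (n <= N)%N,
  s <= rescale N n <= s + mesh N & forall k, (n <= k)%N = (s < rescale N k)].
Proof.
apply: filterS (near_cut s) => N [X [X0 XN H]].
have /andP[t1 t2] := truncn_itv X0.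
exists (Num.truncn X).+1; split.
- by rewrite -(ler_nat R) (le_trans _ XN) // -natr1; lra.
- by rewrite -!H (ltW t2) -natr1 lerD2r.
- move=> k; rewrite ltNge -H -ltNge; apply/idP/idP => [nk|Xk].
    by rewrite (lt_le_trans t2) // ler_nat.
  by rewrite -(ltr_nat R) (le_lt_trans t1).
Qed.

(** The integer part of $hN$, used as reference point. *)
Definition lattice_mean N := Num.truncn (h * N%:R).

Lemma lattice_mean_itv N : (lattice_mean N)%:R <= h * N%:R < (lattice_mean N).+1%:R.
Proof. by apply: truncn_itv; rewrite mulr_ge0 // ltW. Qed.

Lemma rescale_mean N : 0 < mesh N -> - mesh N <= rescale N (lattice_mean N) <= 0.
Proof.
move=> d0; have /andP[t1 t2] := lattice_mean_itv N.
rewrite /rescale pmulr_lle0 ?subr_le0 //.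
rewrite -natr1 in t2; rewrite t1 andbT -mulN1r ler_pM2r //; lra.
Qed.

Lemma lattice_mean_le N : (lattice_mean N <= N)%N.
Proof.
rewrite -(ler_nat R); apply: (@le_trans _ _ (h * N%:R)).
  by have /andP[] := lattice_mean_itv N.
by rewrite ler_piMl // ltW.
Qed.

Variable P : nat -> nat -> R.

(** The ratios $P(k+1)/P(k)$ agree with those of a Gaussian of mean $hN$ and
    standard deviation $\tau\sqrt N$, up to a factor $e^{o(N^{-1/2})}$ uniform
    over bounded windows. *)
Definition gaussian_ratios : Prop := forall T e, 0 < e ->
  \forall N \near \oo, forall k, `|rescale N k| <= T -> 0 < P N k /\
    expR (- (rescale N k * mesh N) - e * mesh N) * P N k <= P N k.+1
      <= expR (- (rescale N k * mesh N) + e * mesh N) * P N k.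

Hypothesis P_loc : gaussian_ratios.

(** The mass at $k$ with the Gaussian factor divided out. *)
Definition flat N k : R := P N k * expR (rescale N k ^+ 2 / 2).

Lemma flatE N k : P N k = flat N k * expR (- (rescale N k ^+ 2 / 2)).
Proof. by rewrite /flat -mulrA -expRD subrr expR0 mulr1. Qed.

Lemma near_flat_step T e : 0 < e -> \forall N \near \oo,
  forall k, `|rescale N k| <= T -> 0 < flat N k /\
    expR (- (e * mesh N)) * flat N k <= flat N k.+1 <= expR (e * mesh N) * flat N k.
Proof.
move=> e0; have e20 : 0 < e / 2 by lra.
apply: filterS2 (P_loc T e20) (near_mesh e0) => N H /andP[d0 de] k kT.
have [P0 /andP[lo hi]] := H k kT.
have eS : rescale N k.+1 ^+ 2 / 2 =
    rescale N k ^+ 2 / 2 + rescale N k * mesh N + mesh N * mesh N / 2.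
  by rewrite rescaleS; field.
have dd : 0 <= mesh N * mesh N <= e * mesh N.
  by rewrite mulr_ge0 ?(ltW d0) //= ler_pM2r.
split; first by rewrite /flat mulr_gt0 ?expR_gt0.
rewrite /flat; apply/andP; split.
  apply: le_trans (ler_wpM2r (expR_ge0 _) lo).
  rewrite mulrCA [leRHS]mulrAC mulrC ler_wpM2r ?(ltW P0) // -!expRD ler_expR eS.
  lra.
apply: le_trans (ler_wpM2r (expR_ge0 _) hi) _.
rewrite mulrAC mulrCA [leRHS]mulrC ler_wpM2r ?(ltW P0) // -!expRD ler_expR eS.
lra.
Qed.

(** The function [flat] is asymptotically constant: a window of width $2T$ has
    $O(1/\mathrm{mesh})$ points, each contributing a factor
    $e^{o(\mathrm{mesh})}$. *)
Lemma near_flat T e : 0 < e -> \forall N \near \oo,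
  forall k n, `|rescale N k| <= T -> `|rescale N n| <= T ->
    0 < flat N k /\ flat N n <= expR e * flat N k.
Proof.
move=> e0.
have [T0|T0] := ltP T 0.
  (* the window is empty *)
  by near=> N => k n kT; have := le_lt_trans kT T0; rewrite ltNge normr_ge0.
have [e' e'0 eE] : exists2 e', 0 < e' & e' * (2 * T + 1) = e.
  by exists (e / (2 * T + 1)); [rewrite divr_gt0 //; lra|rewrite divfK //; lra].
have d1 := near_mesh ltr01.
apply: filterS2 (near_flat_step T e'0) d1 => N H /andP[d0 _].
have step k j : `|rescale N k| <= T -> `|rescale N (k + j)%N| <= T ->
    expR (- (e' * (j%:R * mesh N))) * flat N k <= flat N (k + j)%N
      <= expR (e' * (j%:R * mesh N)) * flat N k.
  move=> kT; elim: j => [|j IH] jT.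
    by rewrite addn0 mul0r mulr0 oppr0 expR0 !mul1r lexx.
  have jT' : `|rescale N (k + j)%N| <= T.
    move: kT jT; rewrite !ler_norml => /andP[k1 k2] /andP[j1 j2].
    apply/andP; split; first by rewrite (le_trans k1) // rescale_le // leq_addr.
    by rewrite (le_trans _ j2) // rescale_le // leq_add2l.
  have [f0 /andP[f1 f2]] := H _ jT'.
  have /andP[g1 g2] := IH jT'.
  have -> : e' * (j.+1%:R * mesh N) = e' * mesh N + e' * (j%:R * mesh N).
    by rewrite -natr1; ring.
  rewrite opprD !expRD -!mulrA addnS; apply/andP; split.
    by rewrite (le_trans _ f1) // ler_wpM2l ?expR_ge0.
  by rewrite (le_trans f2) // ler_wpM2l ?expR_ge0.
have bound k j : `|rescale N k| <= T -> `|rescale N (k + j)%N| <= T ->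
    e' * (j%:R * mesh N) <= e.
  rewrite !ler_norml => /andP[k1 k2] /andP[j1 j2].
  have ej := rescaleB N (leq_addr j k); rewrite addKn in ej.
  rewrite -eE ler_pM2l //; lra.
move=> k n kT nT; split; first by case: (H _ kT).
have [kn|/ltnW nk] := leqP k n.
  have := step k (n - k)%N; have := bound k (n - k)%N.
  rewrite subnKC // => /(_ kT nT) b /(_ kT nT) /andP[_ s].
  have [f0 _] := H _ kT.
  by rewrite (le_trans s) // ler_pM2r // ler_expR.
have := step n (k - n)%N; have := bound n (k - n)%N.
rewrite subnKC // => /(_ nT kT) b /(_ nT kT) /andP[s _].
have [f0 _] := H _ nT.
rewrite -ler_pdivrMl ?expR_gt0 // -expRN (le_trans _ s) // ler_pM2r //.
by rewrite ler_expR lerN2.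
Unshelve. all: by end_near. Qed.

(** The factor relating the mass at a point to the Gaussian mass of the cell
    to its right. *)
Definition amplitude N : R := flat N (lattice_mean N) / (normal_peak 1 * mesh N).

Lemma near_cell T e : 0 < e -> \forall N \near \oo,
  0 < amplitude N /\ forall k, `|rescale N k| <= T ->
    expR (- e) * (amplitude N * gauss_int (rescale N k) (rescale N k.+1)) <= P N k
      <= expR e * (amplitude N * gauss_int (rescale N k) (rescale N k.+1)).
Proof.
move=> e0; have e20 : 0 < e / 2 by lra.
pose T' := Num.max T 1.
have T'1 : 1 <= T' by rewrite le_max lexx orbT.
have dT : 0 < e / 2 / (T' + 1) by rewrite divr_gt0 //; lra.
near=> N.
have F : forall k n, `|rescale N k| <= T' -> `|rescale N n| <= T' ->
    0 < flat N k /\ flat N n <= expR (e / 2) * flat N k.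
  by near: N; exact: near_flat.
have /andP[d0 dle1] : 0 < mesh N <= 1 by near: N; exact: near_mesh.
have /andP[_ dle] : 0 < mesh N <= e / 2 / (T' + 1) by near: N; exact: near_mesh.
have cT : `|rescale N (lattice_mean N)| <= T'.
  by have /andP[c1 c2] := rescale_mean d0; rewrite ler_norml; lra.
have [fc0 _] := F _ _ cT cT.
have pk0 : 0 < normal_peak 1 :> R by exact: normal_peak_gt0.
split; first by rewrite /amplitude divr_gt0 // mulr_gt0.
move=> k kT0; have kT : `|rescale N k| <= T' by rewrite le_max kT0.
have [fk0 f1] := F _ _ kT cT; have [_ f2] := F _ _ cT kT.
(* the exponent x^2 / 2 varies by at most e / 2 over one cell *)
have cell x : rescale N k <= x <= rescale N k.+1 ->
    `|x ^+ 2 / 2 - rescale N k ^+ 2 / 2| <= e / 2.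
  rewrite rescaleS => /andP[x1 x2].
  have -> : x ^+ 2 / 2 - rescale N k ^+ 2 / 2 =
     (x - rescale N k) * ((x + rescale N k) / 2) by field.
  rewrite normrM; rewrite ler_pdivlMr in dle; last by lra.
  apply: le_trans dle; apply: ler_pM; rewrite ?normr_ge0 //.
    by rewrite ger0_norm; lra.
  by move: kT; rewrite !ler_norml => /andP[k1 k2]; lra.
have st : rescale N k <= rescale N k.+1 by rewrite rescale_le.
have ed : rescale N k.+1 - rescale N k = mesh N by rewrite rescaleS; ring.
have G1 : gauss_int (rescale N k) (rescale N k.+1) <=
    expR (e / 2) * normal_pdf 0 1 (rescale N k) * mesh N.
  rewrite -ed; apply: gauss_int_le => // x /cell; rewrite ler_norml => /andP[c1 c2].
  rewrite !std_normal_pdfE mulrCA ler_pM2l // -expRD ler_expR; lra.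
have G2 : expR (- (e / 2)) * normal_pdf 0 1 (rescale N k) * mesh N <=
    gauss_int (rescale N k) (rescale N k.+1).
  rewrite -[X in _ * X <= _]ed; apply: gauss_int_ge => // x /cell.
  rewrite ler_norml => /andP[c1 c2].
  rewrite !std_normal_pdfE mulrCA ler_pM2l // -expRD ler_expR; lra.
have A0 : 0 < amplitude N by rewrite /amplitude divr_gt0 // mulr_gt0.
have eA : amplitude N * (normal_pdf 0 1 (rescale N k) * mesh N) =
   flat N (lattice_mean N) * expR (- (rescale N k ^+ 2 / 2)).
  by rewrite /amplitude std_normal_pdfE; field; rewrite ?gt_eqF.
have eP := flatE N k.
have eh : e = e / 2 + e / 2 by field.
apply/andP; split.
  apply: (@le_trans _ _ (expR (- (e / 2))
    * (amplitude N * (normal_pdf 0 1 (rescale N k) * mesh N)))).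
    rewrite {1}eh opprD expRD -mulrA ler_wpM2l ?expR_ge0 // mulrCA ler_pM2l //.
    by rewrite expRN ler_pdivrMl ?expR_gt0 // mulrA.
  rewrite eA eP mulrA ler_wpM2r ?expR_ge0 // expRN ler_pdivrMl ?expR_gt0 //.
apply: (@le_trans _ _ (expR (e / 2)
  * (amplitude N * (normal_pdf 0 1 (rescale N k) * mesh N)))).
  by rewrite eA eP mulrA ler_wpM2r ?expR_ge0.
rewrite {2}eh expRD -mulrA ler_wpM2l ?expR_ge0 // [leRHS]mulrCA ler_pM2l //.
by rewrite -ler_pdivrMl ?expR_gt0 // -expRN mulrA.
Unshelve. all: by end_near. Qed.

Lemma near_block T e : 0 < e -> \forall N \near \oo,
  0 < amplitude N /\ forall m n, (m <= n)%N -> `|rescale N m| <= T -> `|rescale N n| <= T ->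
    expR (- e) * (amplitude N * gauss_int (rescale N m) (rescale N n))
      <= \sum_(m <= k < n) P N k
      <= expR e * (amplitude N * gauss_int (rescale N m) (rescale N n)).
Proof.
move=> e0; apply: filterS2 (near_cell T e0) (near_mesh ltr01) => N [A0 H] /andP[d0 _].
split=> // m n /subnKC <-; move: (n - m)%N => {n} j mT.
have gss s : gauss_int s s = 0.
  by apply/le_anti; rewrite gauss_int_ge0 (le_trans (gauss_int_le_len _)) ?subrr.
elim: j => [|j IH] jT; first by rewrite addn0 big_geq // gss !mulr0 lexx.
have jT' : `|rescale N (m + j)%N| <= T.
  move: mT jT; rewrite !ler_norml => /andP[k1 k2] /andP[j1 j2].
  apply/andP; split; first by rewrite (le_trans k1) // rescale_le // leq_addr.
  by rewrite (le_trans _ j2) // rescale_le // leq_add2l.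
have /andP[i1 i2] := IH jT'; have /andP[c1 c2] := H _ jT'.
rewrite addnS big_nat_recr ?leq_addr //=.
rewrite (@gauss_intD _ _ (rescale N (m + j)%N)) ?rescale_le ?leq_addr //.
by rewrite !mulrDr; lra.
Qed.

(** Mass of the points whose rescaled value lies in $(a, b)$. *)
Definition window N (a b : R) : R :=
  \sum_(k < N.+1 | a < rescale N k < b) P N k.

Lemma near_window (a b : R) : a < b -> \forall N \near \oo, exists m n,
  [/\ (m <= n <= N)%N, a <= rescale N m <= a + mesh N,
    b <= rescale N n <= b + mesh N & window N a b = \sum_(m <= k < n) P N k].
Proof.
move=> ab; apply: filterS2 (near_gt_cut a) (near_ge_cut b).
move=> N [m [mN ma Hm]] [n [nN nb Hn]]; exists m, n.
have mn : (m <= n)%N by rewrite Hm (lt_le_trans ab); case/andP: nb.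
split=> //; first by rewrite mn.
rewrite /window -(big_mkord (fun k => a < rescale N k < b)).
rewrite (@big_cat_nat _ _ _ n) //=; last exact: leqW.
rewrite (@big_cat_nat _ _ _ m) //=.
rewrite [X in X + _ + _]big_nat_cond big1 ?add0r; last first.
  move=> k /andP[/andP[_ km]]; rewrite -Hm leqNgt km //=.
rewrite [X in _ + X]big_nat_cond [X in _ + X]big1 ?addr0; last first.
  move=> k /andP[/andP[nk _]] /andP[_]; rewrite Hn in nk.
  by rewrite ltNge nk.
rewrite big_nat_cond [RHS]big_nat_cond; apply: eq_bigl => k.
rewrite andbT; case: (boolP (m <= k < n)%N) => //= /andP[mk kn].
by rewrite -Hm mk ltNge -Hn -ltnNge kn.
Qed.

Lemma expR_le1D2 e : 0 <= e <= 2^-1 -> expR e <= 1 + 2 * e.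
Proof.
move=> /andP[e0 e1]; have := expR_ge1Dx (- e); rewrite expRN => H.
have E0 := expR_gt0 e.
have {}H : (1 - e) * expR e <= 1 by rewrite -ler_pdivlMr // mul1r.
have : (1 + 2 * e) * ((1 - e) * expR e) <= (1 + 2 * e) * 1 by rewrite ler_wpM2l //; lra.
have : 0 <= e * (1 - 2 * e) * expR e by rewrite !mulr_ge0 ?(ltW E0) //; lra.
nra.
Qed.

Lemma near_amplitude_gt0 : \forall N \near \oo, 0 < amplitude N.
Proof. by apply: filterS (near_cell 1 ltr01) => N []. Qed.

Lemma window_cvg (a b : R) : a < b ->
  window N a b / amplitude N @[N --> \oo] --> gauss_int a b.
Proof.
move=> ab; apply/cvgrPdist_le => /= e e0.
have [e' /andP[e'0 e'1] e'e] : exists2 e', 0 < e' <= 2^-1 & 4 * e' <= e.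
  exists (Num.min 2^-1 (e / 4)); first by rewrite lt_min ge_min lexx /= andbT; lra.
  have : Num.min 2^-1 (e / 4) <= e / 4 by rewrite ge_min lexx orbT.
  lra.
have e20 : 0 < e / 2 by lra.
pose T := `|a| + `|b| + 1.
near=> N.
have [m [n [/andP[mn nN] /andP[m1 m2] /andP[n1 n2] ->]]] : exists m n,
  [/\ (m <= n <= N)%N, a <= rescale N m <= a + mesh N,
    b <= rescale N n <= b + mesh N & window N a b = \sum_(m <= k < n) P N k].
  by near: N; exact: near_window.
have /andP[d0 d1] : 0 < mesh N <= 1 by near: N; exact: near_mesh.
have /andP[_ d2] : 0 < mesh N <= e / 2 by near: N; exact: near_mesh.
have [A0 H] : 0 < amplitude N /\ forall m n, (m <= n)%N ->
    `|rescale N m| <= T -> `|rescale N n| <= T ->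
    expR (- e') * (amplitude N * gauss_int (rescale N m) (rescale N n))
      <= \sum_(m <= k < n) P N k
      <= expR e' * (amplitude N * gauss_int (rescale N m) (rescale N n)).
  by near: N; exact: near_block.
have [a1 a2 b1 b2] : [/\ a <= `|a|, - a <= `|a|, b <= `|b| & - b <= `|b|].
  by split; rewrite ler_normr lexx ?orbT.
have mT : `|rescale N m| <= T by rewrite ler_norml /T; lra.
have nT : `|rescale N n| <= T by rewrite ler_norml /T; lra.
have /andP[s1 s2] := H m n mn mT nT.
set S := \sum_(m <= k < n) P N k in s1 s2 *; set G := gauss_int _ _ in s1 s2.
have G0 : 0 <= G by exact: gauss_int_ge0.
have G1 : G <= 1 by exact: gauss_int_le1.
have s1' : expR (- e') * G <= S / amplitude N by rewrite ler_pdivlMr // -mulrA [G * _]mulrC.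
have s2' : S / amplitude N <= expR e' * G by rewrite ler_pdivrMr // -mulrA [G * _]mulrC.
have x1 : expR e' <= 1 + 2 * e' by apply: expR_le1D2; rewrite ltW.
have x2 : 1 - e' <= expR (- e') by exact: expR_ge1Dx.
have y1 : expR e' * G <= (1 + 2 * e') * G by rewrite ler_wpM2r.
have y2 : (1 - e') * G <= expR (- e') * G by rewrite ler_wpM2r.
have y3 : e' * G <= e' by rewrite ler_piMr // ltW.
have mn' : rescale N m <= rescale N n by rewrite rescale_le.
have g1 := gauss_intD m1 mn'; have g2 := gauss_intD (ltW ab) n1.
have g3 := gauss_int_ge0 a (rescale N m); have g4 := gauss_int_le_len m1.
have g5 := gauss_int_ge0 b (rescale N n); have g6 := gauss_int_le_len n1.
rewrite -/G in g1; rewrite ler_norml; apply/andP; split; lra.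
Unshelve. all: by end_near. Qed.

End LocalLimit.

(** * Tails and normalization *)

Section WindowLimit.
Variables (R : realType) (h tau : R) (P : nat -> nat -> R).
Hypotheses (h0 : 0 < h) (h1 : h < 1) (tau0 : 0 < tau).
Hypothesis P_loc : gaussian_ratios h tau P.
Local Notation mesh := (mesh tau).
Local Notation rescale := (rescale h tau).
Local Notation lattice_mean := (lattice_mean h).
Local Notation flat := (flat h tau P).
Local Notation amplitude := (amplitude h tau P).
Local Notation window := (window h tau P).
Implicit Types (T e : R) (N : nat).
Hypothesis P_ge0 : \forall N \near \oo, forall k, 0 <= P N k.
Hypothesis P_sum : \forall N \near \oo, \sum_(k < N.+1) P N k = 1.
Hypothesis P_lc : \forall N \near \oo, forall i j m, (i <= j)%N ->
  P N i * P N (j + m)%N <= P N (i + m)%N * P N j.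

Lemma near_mass (a b : R) : \forall N \near \oo, 0 <= window N a b <= 1.
Proof.
apply: filterS2 P_ge0 P_sum => N p0 p1; rewrite sumr_ge0 //= -p1.
rewrite [leRHS](bigID (fun k : 'I_N.+1 => a < rescale N k < b)) /= lerDl.
exact: sumr_ge0.
Qed.

(** Bound on the mass beyond $T$ on either side: a constant times
    $e^{-(T-1)^2/2}$, where $T - 1$ instead of $T$ absorbs one mesh. *)
Definition tail_bound T : R := expR (2 - (T - 1) ^+ 2 / 2).

(** By log-concavity the mass function shifted by $M$ is at most
    $P(c+M)/P(c)$ times itself beyond the reference point $c$; summing, the
    whole tail beyond $c + M$ is at most $P(c+M)/P(c)$, and similarly on the
    left. *)
Lemma near_tail T : 2 <= T -> \forall N \near \oo,
  1 - 2 * tail_bound T <= window N (- T) T.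
Proof.
move=> T2; have TT : - T < T by lra.
near=> N.
have [m [n [/andP[mn nN] /andP[m1 m2] /andP[n1 n2] ->]]] : exists m n,
  [/\ (m <= n <= N)%N, - T <= rescale N m <= - T + mesh N,
    T <= rescale N n <= T + mesh N & window N (- T) T = \sum_(m <= k < n) P N k].
  by near: N; exact: near_window.
have /andP[d0 d1] : 0 < mesh N <= 1 by near: N; exact: near_mesh.
have p0 : forall k, 0 <= P N k by near: N.
have p1 : \sum_(k < N.+1) P N k = 1 by near: N.
have lc : forall i j m, (i <= j)%N -> P N i * P N (j + m)%N <= P N (i + m)%N * P N j.
  by near: N.
have F : forall k n, `|rescale N k| <= T + 1 -> `|rescale N n| <= T + 1 ->
    0 < flat N k /\ flat N n <= expR 1 * flat N k by near: N; exact: near_flat.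
have /andP[c1 c2] := rescale_mean h0 d0.
have cT : `|rescale N (lattice_mean N)| <= T + 1 by rewrite ler_norml; lra.
have mT : `|rescale N m| <= T + 1 by rewrite ler_norml; lra.
have nT : `|rescale N n| <= T + 1 by rewrite ler_norml; lra.
have [fc0 fm] := F _ _ cT mT; have [_ fn] := F _ _ cT nT.
have Pc0 : 0 < P N (lattice_mean N) by rewrite (flatE h tau P) mulr_gt0 ?expR_gt0.
have sub (u v : nat) : (u <= v <= N.+1)%N -> \sum_(u <= k < v) P N k <= 1.
  move=> /andP[uv vN]; rewrite -p1 -(big_mkord xpredT) [leRHS](@big_cat_nat _ _ _ v) //=.
  rewrite (@big_cat_nat _ _ _ u 0) //= -addrA addrCA lerDl.
  by rewrite addr_ge0 // sumr_ge0.
have sq1 : 1 * rescale N (lattice_mean N) ^+ 2 <= 1.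
  by rewrite mul1r -sqrrN expr_le1 //; lra.
have edge k : `|rescale N k| <= T + 1 -> flat N k <= expR 1 * flat N (lattice_mean N) ->
    (T - 1) ^+ 2 <= rescale N k ^+ 2 -> P N k <= tail_bound T * P N (lattice_mean N).
  move=> kT fk sqk; rewrite 2!(flatE h tau P).
  apply: (@le_trans _ _ (expR 1 * flat N (lattice_mean N) * expR (- (rescale N k ^+ 2 / 2)))).
    by rewrite ler_wpM2r ?expR_ge0.
  rewrite [leRHS]mulrCA [leLHS]mulrAC [leLHS]mulrC ler_pM2l // /tail_bound -!expRD ler_expR; lra.
(* the right tail, shifted back by n - lattice_mean N *)
have rn : \sum_(n <= k < N.+1) P N k <= tail_bound T.
  have cn : (lattice_mean N <= n)%N by rewrite -(rescale_le h _ _ d0); lra.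
  have en : P N n <= tail_bound T * P N (lattice_mean N).
    by apply: edge => //; rewrite ler_sqr ?nnegrE; lra.
  rewrite -(ler_pM2r Pc0) (le_trans _ en) // mulr_suml.
  rewrite -{1}(subnKC cn) big_addn.
  apply: (@le_trans _ _ (\sum_(lattice_mean N <= k < N.+1 - (n - lattice_mean N)) P N k * P N n)).
    rewrite big_nat [leRHS]big_nat; apply: ler_sum => k /andP[ck _].
    by have := lc _ _ (n - lattice_mean N)%N ck; rewrite subnKC // mulrC [leRHS]mulrC.
  rewrite -mulr_suml; apply: ler_piMl; [exact: p0|apply: sub].
  by move: cn nN; clear; lia.
(* the left tail, shifted up by lattice_mean N - m *)
have rm : \sum_(0 <= k < m) P N k <= tail_bound T.
  have mc : (m <= lattice_mean N)%N.
    rewrite leqNgt; apply/negP => cm.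
    by move: cm; rewrite -(rescale_le h _ _ d0) rescaleS; lra.
  have em : P N m <= tail_bound T * P N (lattice_mean N).
    by apply: edge => //; rewrite -[leRHS]sqrrN ler_sqr ?nnegrE; lra.
  rewrite -(ler_pM2r Pc0) (le_trans _ em) // mulr_suml.
  apply: (@le_trans _ _ (\sum_(0 <= k < m) P N (k + (lattice_mean N - m))%N * P N m)).
    rewrite big_nat [leRHS]big_nat; apply: ler_sum => k /andP[_ km].
    by have := lc _ _ (lattice_mean N - m)%N (ltnW km); rewrite subnKC.
  rewrite -mulr_suml; apply: ler_piMl; first exact: p0.
  rewrite -[m in \sum_(_ <= _ < m) _](subKn mc).
  rewrite -(big_addn 0 (lattice_mean N) _ xpredT (P N)); apply: sub.
  by rewrite add0n leq_subr ltnW // ltnS lattice_mean_le.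
have : \sum_(0 <= k < m) P N k + \sum_(m <= k < n) P N k + \sum_(n <= k < N.+1) P N k = 1.
  rewrite -p1 -(big_mkord xpredT) [RHS](@big_cat_nat _ _ _ n) //=; last exact: leqW.
  by rewrite [X in _ = X + _](@big_cat_nat _ _ _ m) //=.
lra.
Unshelve. all: by end_near. Qed.

Lemma tail_bound_small e : 0 < e -> \forall n \near \oo, tail_bound n%:R <= e.
Proof.
move=> e0; near=> n.
have n1 : e^-1 + 6 <= n%:R :> R.
  by near: n; exact: nbhs_infty_ger.
have ei0 : 0 < e^-1 by rewrite invr_gt0.
have big : e^-1 <= (n%:R - 1) ^+ 2 / 2 - 2.
  have : 5 * (n%:R - 1) <= (n%:R - 1) ^+ 2 :> R by by rewrite expr2; nra.
  lra.
have -> : e = e^-1^-1 by rewrite invrK.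
rewrite /tail_bound -[_ - _]opprK opprB expRN lef_pV2 ?posrE ?expR_gt0 //.
by rewrite (le_trans _ (expR_ge1Dx _)) //; lra.
Unshelve. all: by end_near. Qed.

(** On $[-n, n]$ both the actual and the Gaussian masses are close to $1$, so
    their asymptotic ratio $A_N$ is close to $1$. *)
Lemma amplitude_cvg1 : (amplitude N)^-1 @[N --> \oo] --> (1 : R).
Proof.
apply/cvgrPdist_le => /= e e0.
have [e' e'0 [e'1 e'e]] : exists2 e', 0 < e' & e' <= 8^-1 /\ 8 * e' <= e.
  exists (Num.min 8^-1 (e / 8)); first by rewrite lt_min; apply/andP; split; lra.
  rewrite ge_min lexx; split => //.
  have : Num.min 8^-1 (e / 8) <= e / 8 by rewrite ge_min lexx orbT.
  lra.
have [n [n1 tn gn]] : exists n : nat, [/\ 2 <= n%:R :> R, tail_bound n%:R <= e' &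
    `|1 - gauss_int (- n%:R) n%:R| <= e'].
  near \oo => n; exists n; split.
  - by near: n; exact: nbhs_infty_ger.
  - by near: n; exact: tail_bound_small.
  - by near: n; have /cvgrPdist_le := @gauss_int_cvg1 R; apply.
have nn : - n%:R < n%:R :> R by lra.
near=> N.
have A0 : 0 < amplitude N by near: N; exact: near_amplitude_gt0.
have lo : 1 - 2 * tail_bound n%:R <= window N (- n%:R) n%:R by near: N; exact: near_tail.
have /andP[_ hi] : 0 <= window N (- n%:R) n%:R <= 1 by near: N; exact: near_mass.
have cl : `|gauss_int (- n%:R) n%:R - window N (- n%:R) n%:R / amplitude N| <= e'.
  by near: N; have /cvgrPdist_le := window_cvg h0 h1 tau0 P_loc nn; apply.
move: gn cl; set W := window _ _ _ in lo hi *; set G := gauss_int _ _.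
set A := (amplitude N)^-1; have A'0 : 0 < A by rewrite invr_gt0.
rewrite !ler_norml => /andP[g1 g2] /andP[c1 c2]; apply/andP.
have w1 : W * A <= A by rewrite ler_piMl // ltW.
have w2 : (1 - 2 * e') * A <= W * A by rewrite ler_pM2r //; lra.
have A2 : A <= 2.
  have : (1 - 2 * 8^-1) * A <= (1 - 2 * e') * A by rewrite ler_pM2r //; lra.
  lra.
have : e' * A <= e' * 2 by rewrite ler_pM2l.
split; lra.
Unshelve. all: by end_near. Qed.

(** Central limit theorem for log-concave families with Gaussian ratios. *)
Theorem window_gauss_cvg (a b : R) : a < b ->
  window N a b @[N --> \oo] --> gauss_int a b.
Proof.
move=> ab; have c1 := amplitude_cvg1; have c2 := window_cvg h0 h1 tau0 P_loc ab.
have := cvgM c2 (cvgV (oner_neq0 _) c1).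
rewrite invr1 mulr1 => c3.
have E : \forall N \near \oo,
    window N a b / amplitude N * ((amplitude N)^-1)^-1 = window N a b.
  apply: filterS (near_amplitude_gt0 h0 tau0 P_loc) => N A0.
  by rewrite invrK divfK // gt_eqF.
exact: cvg_trans (near_eq_cvg E) (c3 _ _).
Qed.

End WindowLimit.

(** * Asymptotics of the Mallows parameter *)

Section Log1mExp.
Variable R : realType.
Implicit Types (u v e : R).

(** First-order Taylor expansion in quantified form. *)
Lemma is_derive_first_order (f : R -> R) u d e : is_derive u (1 : R) f d -> 0 < e ->
  exists2 eta, 0 < eta &
    forall v, `|v - u| <= eta -> `|f v - f u - d * (v - u)| <= e * `|v - u|.
Proof.
move=> [df <-] e0; have /cvgrPdist_le /(_ e e0) /nbhs_ballP[eta /= eta0 H] := df.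
exists (eta / 2); first by lra.
move=> v vu; have [->|vNu] := eqVneq v u; first by rewrite !subrr mulr0 subrr normr0 mulr0.
have vu0 : v - u != 0 by rewrite subr_eq0.
have /H /(_ vu0) : ball (0 : R) eta (v - u).
  by rewrite /ball /= sub0r normrN; lra.
have -> : (v - u) *: (1 : R) = v - u by rewrite /GRing.scale /= mulr1.
rewrite /= subrK -/('D_1 f u) => H'.
rewrite -ler_pdivrMr ?normr_gt0 // -normf_div mulrBl mulfK // distrC.
by rewrite mulrC.
Qed.

(** The function $u \mapsto \ln(1 - e^{-u})$. *)
Definition ln1mexp u : R := ln (1 - expR (- u)).

(** The derivative of [ln1mexp]. *)
Definition dln1mexp u : R := expR (- u) / (1 - expR (- u)).

Lemma expRN_lt1 u : 0 < u -> 0 < 1 - expR (- u).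
Proof. by move=> u0; rewrite subr_gt0 expR_lt1 oppr_lt0. Qed.

Lemma expR_ln1mexp u : 0 < u -> expR (ln1mexp u) = 1 - expR (- u).
Proof. by move=> u0; rewrite lnK // posrE expRN_lt1. Qed.

Lemma is_derive_ln1mexp u : 0 < u -> is_derive u 1 ln1mexp (dln1mexp u).
Proof.
move=> u0; have E0 := expRN_lt1 u0.
rewrite /dln1mexp mulrC.
have D : is_derive u (1 : R) (fun x : R => 1 - expR (- x)) (expR (- u)).
  have -> : expR (- u) = 0 - expR (- u) * (-1) by ring.
  apply: is_deriveB; apply: (@is_derive1_comp _ expR (fun x => - x)).
exact: (@is_derive1_comp _ (@ln R) (fun x : R => 1 - expR (- x)) u _ _ (is_derive1_ln E0) D).
Qed.

Variables (beta : R) (beta0 : 0 < beta).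

(** The rate $\lambda_N$ with $1 - \beta/N = e^{-\lambda_N}$. *)
Definition mallows_rate (N : nat) : R := - ln (1 - beta / N%:R).

(** For $N$ large, $0 < q < 1$ and $\lambda_N = \beta/N + O(N^{-2})$. *)
Definition mallows_rate_estimate N : Prop :=
  [/\ 0 < 1 - beta / N%:R < 1, expR (- mallows_rate N) = 1 - beta / N%:R,
    0 < mallows_rate N &
    `|mallows_rate N - beta / N%:R| <= 2 * beta ^+ 2 / (N%:R * N%:R)].

Lemma near_mallows_rate : \forall N \near \oo, mallows_rate_estimate N.
Proof.
rewrite /mallows_rate_estimate; near=> N.
have N1 : 1 + 2 * beta <= N%:R by near: N; exact: nbhs_infty_ger.
have N0 : 0 < N%:R :> R by apply: lt_le_trans N1; rewrite addr_gt0 ?mulr_gt0.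
set z := beta / N%:R.
have z0 : 0 < z by rewrite divr_gt0.
have z1 : z <= 2^-1 by rewrite ler_pdivrMr //; lra.
have q0 : 0 < 1 - z by lra.
have r1 : z <= mallows_rate N.
  by rewrite lerNr le_ln1Dx // ltrN2 -/z; lra.
have r2 : mallows_rate N <= z + 2 * z ^+ 2.
  rewrite /mallows_rate -/z -lnV ?posrE //.
  have -> : (1 - z)^-1 = 1 + z / (1 - z) by field; rewrite gt_eqF.
  apply: le_trans (le_ln1Dx _) _.
    by rewrite (@lt_trans _ _ 0) ?divr_gt0 // oppr_lt0.
  rewrite ler_pdivrMr // expr2; nra.
split.
- by rewrite q0; lra.
- by rewrite opprK lnK.
- by lra.
- have -> : 2 * beta ^+ 2 / (N%:R * N%:R) = 2 * z ^+ 2.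
    by rewrite /z; field; rewrite gt_eqF.
  by rewrite ger0_norm; lra.
Unshelve. all: by end_near. Qed.

(** Positivity of $n$ and first-order expansions of $\lambda_N n$ and $\ln(1-e^{-\lambda_N n})$, with
    error $e/\sqrt N$, at all $n = wN + z + O(1)$ with $|z| \le T\sqrt N$. The
    margin $3$ leaves room for the rounding of $xN$ and $yN$. *)
Definition ln1mexp_expansion w T e N : Prop :=
  forall n z : R, `|n - (w * N%:R + z)| <= 3 -> `|z| <= T * Num.sqrt N%:R ->
  [/\ 0 < n,
    `|mallows_rate N * n - beta * w - beta * z / N%:R| <= e / Num.sqrt N%:R &
    `|ln1mexp (mallows_rate N * n) - ln1mexp (beta * w)
       - dln1mexp (beta * w) * (beta * z / N%:R)| <= e / Num.sqrt N%:R].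

Lemma near_ln1mexp w T e : 0 < w -> w < 1 -> 0 < e ->
  \forall N \near \oo, ln1mexp_expansion w T e N.
Proof.
move=> w0 w1 e0; rewrite /ln1mexp_expansion.
have [T0|T0] := ltP T 0.
  (* no z satisfies the bound *)
  near=> N => n z _ zT; have : T * Num.sqrt N%:R <= 0 by rewrite mulr_le0_ge0 ?sqrtr_ge0 // ltW.
  have r0 : 0 < Num.sqrt N%:R :> R by apply: lt_le_trans ltr01 _; near: N; exact: near_sqrt_ge.
  move=> _; exfalso; have := le_lt_trans zT (_ : _ < 0).
  by rewrite pmulr_llt0 // => /(_ T0); rewrite ltNge normr_ge0.
have u0 : 0 < beta * w by rewrite mulr_gt0.
set u := beta * w in u0 *.
(* Bound on N |lambda_N n - beta w - beta z / N|: the replacement of lambda_N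
   by beta / N costs 8 beta^2 since |n| <= 4 N, the margin 3 costs 3 beta. *)
pose C := 3 * beta + 8 * beta ^+ 2.
have C0 : 0 < C by rewrite addr_gt0 // mulr_gt0 // exprn_gt0.
pose M := beta * T + 1.
have M0 : 0 < M by rewrite ltr_wpDl // mulr_ge0 // ltW.
have e10 : 0 < e / (2 * M) by rewrite divr_gt0 // mulr_gt0.
have [eta eta0 Heta] := is_derive_first_order (is_derive_ln1mexp u0) e10.
pose D := `|dln1mexp u|.
near=> N => n z nz zT.
have [_ _ l0 lr] : mallows_rate_estimate N.
  by near: N; exact: near_mallows_rate.
set l := mallows_rate N in l0 lr *.
have r3 : 3 <= Num.sqrt N%:R :> R by near: N; exact: near_sqrt_ge.
have rT : T <= Num.sqrt N%:R by near: N; exact: near_sqrt_ge.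
have rC : C <= Num.sqrt N%:R by near: N; exact: near_sqrt_ge.
have rCe : C / e <= Num.sqrt N%:R by near: N; exact: near_sqrt_ge.
have rMe : M / eta <= Num.sqrt N%:R by near: N; exact: near_sqrt_ge.
have rMu : (M + 1) / u <= Num.sqrt N%:R by near: N; exact: near_sqrt_ge.
have rD : 2 * D * C / e <= Num.sqrt N%:R by near: N; exact: near_sqrt_ge.
have eN : N%:R = Num.sqrt N%:R * Num.sqrt N%:R :> R by rewrite -expr2 sqr_sqrtr.
set r := Num.sqrt N%:R in r3 rT rC rCe rMe rMu rD eN zT *.
have r0 : 0 < r by lra.
have N0 : 0 < N%:R :> R by rewrite eN mulr_gt0.
rewrite ler_pdivrMr // in rCe; rewrite ler_pdivrMr // in rMe.
rewrite ler_pdivrMr // in rMu; rewrite ler_pdivrMr // in rD.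
have zN : `|z| <= N%:R by rewrite (le_trans zT) // eN ler_pM2r.
have rN : r <= N%:R by rewrite eN ler_peMl //; lra.
have nN : `|n| <= 4 * N%:R.
  have wN : w * N%:R <= N%:R by rewrite ler_piMl // ltW.
  have wN0 : 0 <= w * N%:R by rewrite mulr_ge0 // ltW.
  move: nz zN; rewrite !ler_norml => /andP[? ?] /andP[? ?]; lra.
have d1 : `|l * n - u - beta * z / N%:R| <= C / N%:R.
  have -> : l * n - u - beta * z / N%:R =
      (l - beta / N%:R) * n + beta / N%:R * (n - (w * N%:R + z)).
    by rewrite /u; field; rewrite gt_eqF.
  apply: le_trans (ler_normD _ _) _.
  have -> : C / N%:R = 2 * beta ^+ 2 / (N%:R * N%:R) * (4 * N%:R) + beta / N%:R * 3.
    by rewrite /C; field; rewrite gt_eqF.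
  apply: lerD; first by rewrite normrM ler_pM.
  have bN : 0 <= beta / N%:R by rewrite divr_ge0 // ltW.
  by rewrite normrM (ger0_norm bN) ler_wpM2l.
have CN : C / N%:R = C / r / r by rewrite eN; field; rewrite gt_eqF.
have d2 : `|l * n - u - beta * z / N%:R| <= e / r.
  by rewrite (le_trans d1) // CN ler_pM2r ?invr_gt0 // ler_pdivrMr // mulrC.
have bz : `|beta * z / N%:R| <= beta * T / r.
  rewrite !normrM normfV !(gtr0_norm beta0) (gtr0_norm N0) ler_pdivrMr //.
  have -> : beta * T / r * N%:R = beta * (T * r) by rewrite eN; field; rewrite gt_eqF.
  by rewrite ler_pM2l.
have vu : `|l * n - u| <= M / r.
  have -> : l * n - u = (l * n - u - beta * z / N%:R) + beta * z / N%:R by ring.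
  apply: le_trans (ler_normD _ _) _.
  rewrite /M mulrDl addrC lerD // (le_trans d1) // CN ler_pM2r ?invr_gt0 //.
  by rewrite ler_pdivrMr // mul1r.
split=> //.
  have : M / r < u by rewrite ltr_pdivrMr // mulrC; lra.
  rewrite -(pmulr_rgt0 _ l0); move: vu; rewrite ler_norml => /andP[? ?] ?; lra.
have vueta : `|l * n - u| <= eta.
  by rewrite (le_trans vu) // ler_pdivrMr // mulrC.
have H := Heta _ vueta.
have -> : ln1mexp (l * n) - ln1mexp u - dln1mexp u * (beta * z / N%:R) =
  (ln1mexp (l * n) - ln1mexp u - dln1mexp u * (l * n - u)) +
   dln1mexp u * (l * n - u - beta * z / N%:R) by ring.
apply: le_trans (ler_normD _ _) _; rewrite normrM -/D.
have h1 : e / (2 * M) * `|l * n - u| <= e / 2 / r.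
  have -> : e / 2 / r = e / (2 * M) * (M / r).
    by field; rewrite !gt_eqF.
  by rewrite ler_pM2l.
have h2 : D * `|l * n - u - beta * z / N%:R| <= e / 2 / r.
  apply: (@le_trans _ _ (D * (C / N%:R))); first by rewrite ler_wpM2l ?normr_ge0.
  rewrite CN mulrA ler_pM2r ?invr_gt0 // mulrA ler_pdivrMr //.
  by lra.
have -> : e / r = e / 2 / r + e / 2 / r by field; rewrite gt_eqF.
by rewrite lerD // (le_trans H).
Unshelve. all: by end_near. Qed.

End Log1mExp.

(** * Limit shape and variance *)

Section LimitShape.
Variable R : realType.
Variables (beta : R) (beta0 : 0 < beta) (x y : R) (hx : 0 < x < 1) (hy : 0 < y < 1).
Local Notation h := (h_lim beta x y).
Local Notation E := (expR (- beta)).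
Local Notation p := (expR (- (beta * x))).
Local Notation r := (expR (- (beta * y))).
Local Notation den := (p + r - p * r - E).

Lemma shape_order : [/\ 0 < E, E < p, p < 1, E < r & r < 1].
Proof.
have [/andP[x0 x1] /andP[y0 y1]] := (hx, hy).
split; rewrite ?expR_gt0 ?ltr_expR ?expR_lt1 ?oppr_lt0 ?mulr_gt0 //.
  by rewrite ltrN2 gtr_pMr.
by rewrite ltrN2 gtr_pMr.
Qed.

Lemma shape_den_gt0 : 0 < den.
Proof.
have [E0 Ep p1 Er r1] := shape_order.
have : 0 < r * (1 - p) by rewrite mulr_gt0 ?expR_gt0 // subr_gt0.
lra.
Qed.

Lemma expR_h_lim : expR (- (beta * h)) = den / (1 - E).
Proof.
have [E0 Ep p1 Er r1] := shape_order; have d0 := shape_den_gt0.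
have E1 : 0 < 1 - E by lra.
rewrite /h_lim !mulNr mulVKf ?gt_eqF //.
have -> : - (beta * (x + y)) = - (beta * x) + - (beta * y) by ring.
by rewrite expRD opprB expRB !lnK ?posrE.
Qed.

Lemma expR_x_h : expR (- (beta * (x - h))) = p * (1 - E) / den.
Proof.
have -> : - (beta * (x - h)) = - (beta * x) - (- (beta * h)) by ring.
by rewrite expRB expR_h_lim invf_div mulrA.
Qed.

Lemma expR_y_h : expR (- (beta * (y - h))) = r * (1 - E) / den.
Proof.
have -> : - (beta * (y - h)) = - (beta * y) - (- (beta * h)) by ring.
by rewrite expRB expR_h_lim invf_div mulrA.
Qed.

Lemma expR_xy_h : expR (- (beta * (1 - x - y + h))) = E * den / (p * r * (1 - E)).
Proof.
have -> : - (beta * (1 - x - y + h)) =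
    - beta + - (beta * h) - (- (beta * x) + - (beta * y)) by ring.
have E1 : 1 - E != 0 by have [*] := shape_order; rewrite gt_eqF //; lra.
by rewrite expRB !expRD expR_h_lim; field; rewrite E1 !gt_eqF ?expR_gt0.
Qed.

(** The limiting proportions $h$, $x - h$, $y - h$, $1 - x - y + h$ of points in
    the four blocks cut out by $i \le xN$ and $\omega(i) \le yN$ are positive. *)
Lemma h_lim_bounds : [/\ 0 < h, h < x, h < y & 0 < 1 - x - y + h].
Proof.
have [E0 Ep p1 Er r1] := shape_order; have d0 := shape_den_gt0.
have E1 : 0 < 1 - E by lra.
have pr u : expR (- (beta * u)) < 1 -> 0 < u.
  by rewrite expR_lt1 oppr_lt0 pmulr_rgt0.
split.
- apply: pr; rewrite expR_h_lim ltr_pdivrMr //.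
  have : 0 < (1 - p) * (1 - r) by rewrite mulr_gt0; lra.
  lra.
- rewrite -subr_gt0; apply: pr; rewrite expR_x_h ltr_pdivrMr //.
  have : 0 < (1 - p) * (r - E) by rewrite mulr_gt0; lra.
  lra.
- rewrite -subr_gt0; apply: pr; rewrite expR_y_h ltr_pdivrMr //.
  have : 0 < (1 - r) * (p - E) by rewrite mulr_gt0; lra.
  lra.
- apply: pr; rewrite expR_xy_h ltr_pdivrMr; last by rewrite !mulr_gt0 // expR_gt0.
  have : 0 < (p - E) * (r - E) by rewrite mulr_gt0; lra.
  lra.
Qed.

Local Notation a := (expR (- (beta * (x - h)))).
Local Notation b := (expR (- (beta * (y - h)))).
Local Notation c := (expR (- (beta * h))).
Local Notation d := (expR (- (beta * (1 - x - y + h)))).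

(** The equation characterizing $h_\beta$: with $a = e^{-\beta(x-h)}$,
    $b = e^{-\beta(y-h)}$, $c = e^{-\beta h}$, $d = e^{-\beta(1-x-y+h)}$ it
    expresses that the limiting ratio of consecutive masses is $1$. *)
Lemma shape_balance : (1 - a) * (1 - b) = a * b * ((1 - c) * (1 - d)).
Proof.
have [E0 Ep p1 Er r1] := shape_order; have d0 := shape_den_gt0.
rewrite expR_x_h expR_y_h expR_h_lim expR_xy_h; field.
by rewrite !gt_eqF //; lra.
Qed.

(** The logarithm of consecutive ratios vanishes at $hN$ to leading order. *)
Lemma ln1mexp_balance :
  ln1mexp (beta * (x - h)) + ln1mexp (beta * (y - h))
    + beta * (x - h) + beta * (y - h)
  = ln1mexp (beta * h) + ln1mexp (beta * (1 - x - y + h)).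
Proof.
have [h0 hx' hy' h4] := h_lim_bounds; rewrite -subr_gt0 in hx'; rewrite -subr_gt0 in hy'.
have u3 : 0 < beta * h by exact: mulr_gt0.
apply: expR_inj; rewrite !expRD !expR_ln1mexp ?(mulr_gt0 beta0) //.
rewrite shape_balance.
have inv (u : R) : expR u = (expR (- u))^-1 by rewrite expRN invrK.
rewrite (inv (beta * (x - h))) (inv (beta * (y - h))); field.
by rewrite !gt_eqF ?expR_gt0.
Qed.

(** The slope at $hN$ of the logarithm of consecutive ratios is $-\beta/N$ times
    the left-hand side, so this identifies it with $-1/\sigma_{N,\beta}^2$. *)
Lemma dln1mexp_balance :
  2 + dln1mexp (beta * (x - h)) + dln1mexp (beta * (y - h))
    + dln1mexp (beta * h) + dln1mexp (beta * (1 - x - y + h))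
  = expR (d_lim beta x y) ^+ 2.
Proof.
have [h0 hx' hy' h4] := h_lim_bounds; rewrite -subr_gt0 in hx'; rewrite -subr_gt0 in hy'.
have E1 : 0 < 1 - E by exact: expRN_lt1.
have a1 : 0 < 1 - a by rewrite expRN_lt1 ?mulr_gt0.
have b1 : 0 < 1 - b by rewrite expRN_lt1 ?mulr_gt0.
have c1 : 0 < 1 - c by apply: expRN_lt1; exact: mulr_gt0.
have d1 : 0 < 1 - d by rewrite expRN_lt1 ?mulr_gt0.
have a0 : 0 < a by exact: expR_gt0. have b0 : 0 < b by exact: expR_gt0.
have -> : expR (d_lim beta x y) ^+ 2 = (1 - E) / ((1 - a) * (1 - b)).
  rewrite -expRM_natl /d_lim !mulNr.
  have -> : 2 * (2^-1 * ln (1 - E) - 2^-1 * ln (1 - a) - 2^-1 * ln (1 - b))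
    = ln (1 - E) - (ln (1 - a) + ln (1 - b)) by field.
  by rewrite expRB expRD !lnK ?posrE.
(* the four exponents add up to beta *)
have eE : E = a * b * c * d by rewrite -!expRD; congr expR; ring.
have rel := shape_balance.
rewrite /dln1mexp eE.
have -> : c / (1 - c) = c * (1 - d) * (a * b) / ((1 - a) * (1 - b)).
  by rewrite rel; field; rewrite !gt_eqF.
have -> : d / (1 - d) = d * (1 - c) * (a * b) / ((1 - a) * (1 - b)).
  by rewrite rel; field; rewrite !gt_eqF.
apply: (@mulIf _ ((1 - a) * (1 - b))); first by rewrite gt_eqF // mulr_gt0.
rewrite divfK ?gt_eqF ?mulr_gt0 //.
transitivity (2 * ((1 - a) * (1 - b)) + a * (1 - b) + b * (1 - a)
  + c * (1 - d) * (a * b) + d * (1 - c) * (a * b)); first by field; rewrite !gt_eqF.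
move: rel; move: (a) (b) (c) (d) => *; lra.
Qed.

End LimitShape.

(** * Gaussian ratios for the height *)

(** Bookkeeping: seven approximations, each within [err], add up. *)
Lemma ratio_error (R : realFieldType)
    (F1 F2 F3 F4 G1 G2 G3 G4 d1 d2 d3 d4 v1 v2 w1 w2 l s err : R) :
  `|v1 - w1 - - s| <= err -> `|v2 - w2 - - s| <= err ->
  `|F1 - G1 - d1 * - s| <= err -> `|F2 - G2 - d2 * - s| <= err ->
  `|F3 - G3 - d3 * s| <= err -> `|F4 - G4 - d4 * s| <= err -> `|l| <= err ->
  G2 + G1 + w2 + w1 = G3 + G4 ->
  `|F1 + F2 - F3 - F4 + v1 + v2 - l + (2 + d2 + d1 + d3 + d4) * s| <= 7 * err.
Proof.
rewrite !ler_norml => /andP[? ?] /andP[? ?] /andP[? ?] /andP[? ?] /andP[? ?].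
by move=> /andP[? ?] /andP[? ?] ?; apply/andP; split; lra.
Qed.

Section HeightRatios.
Variable R : realType.

Lemma qint_ln1mexp (lam : R) n : 0 < lam -> (0 < n)%N ->
  qint (expR (- lam)) n = expR (ln1mexp (lam * n%:R)) / (1 - expR (- lam)).
Proof.
move=> l0 n0; rewrite qintE; last by rewrite expR_lt1 oppr_lt0.
by rewrite expR_ln1mexp ?mulr_gt0 ?ltr0n // -mulNr expRM_natr.
Qed.

(** Ratio of consecutive masses of the height in exponential form. *)
Lemma height_pmf_step (lam : R) N L K k : 0 < lam -> (L <= N)%N -> (K <= N)%N ->
  (L + K <= N + k)%N -> (k < K)%N -> (k < L)%N ->
  height_pmf (expR (- lam)) N L K k.+1 =
  expR (ln1mexp (lam * (K%:R - k%:R)) + ln1mexp (lam * (L%:R - k%:R))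
        - ln1mexp (lam * (k%:R + 1)) - ln1mexp (lam * (N%:R + k%:R + 1 - L%:R - K%:R))
        + lam * (K%:R - k%:R) + lam * (L%:R - k%:R) - lam)
    * height_pmf (expR (- lam)) N L K k.
Proof.
move=> l0 LN KN LK kK kL; rewrite /height_pmf mulrA; congr (_ / _).
have q1 : expR (- lam) < 1 by rewrite expR_lt1 oppr_lt0.
have Q0 : 1 - expR (- lam) != 0 by rewrite gt_eqF // subr_gt0.
have := inv_gen_ratio (expR_gt0 (- lam)) q1 LN KN LK kK kL.
have n4 : (0 < N + k.+1 - (L + K))%N by lia.
have n1 : (0 < K - k)%N by rewrite subn_gt0.
have n2 : (0 < L - k)%N by rewrite subn_gt0.
rewrite (qint_ln1mexp l0 (ltn0Sn k)) (qint_ln1mexp l0 n4).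
rewrite (qint_ln1mexp l0 n1) (qint_ln1mexp l0 n2).
rewrite !natrB ?(ltnW kK) ?(ltnW kL); [|lia..].
rewrite natrD (natrD _ L K) -natr1 -expRM_natl.
rewrite natrB; last lia.
rewrite !natrD -natr1.
set I := inv_gen _ _ _ _ _; set I' := inv_gen _ _ _ _ _.
have -> : N%:R + (k%:R + 1) - (L%:R + K%:R) = N%:R + k%:R + 1 - L%:R - K%:R :> R by ring.
set f1 := ln1mexp (lam * (K%:R - _)); set f2 := ln1mexp (lam * (L%:R - _)).
set f3 := ln1mexp (lam * (k%:R + 1)); set f4 := ln1mexp (lam * (N%:R + _ + _ - _ - _)).
have -> : f1 + f2 - f3 - f4 + lam * (K%:R - k%:R) + lam * (L%:R - k%:R) - lam =
   f1 + f2 - (f3 + f4 + (K%:R + L%:R - (k%:R + (k%:R + 1))) * - lam) by ring.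
rewrite expRB !expRD; set g := expR (_ * - lam) => H.
have g0 : 0 < g by exact: expR_gt0.
apply: (@mulIf _ (expR f3 / (1 - expR (- lam)) * (expR f4 / (1 - expR (- lam))) * g)).
  by rewrite gt_eqF // !mulr_gt0 ?invr_gt0 ?subr_gt0 ?expR_gt0.
rewrite H; have : g != 0 by rewrite gt_eqF.
move: (expR_eq0 f3) (expR_eq0 f4) Q0 => /negbT; clear.
move: (expR f1) (expR f2) (expR f3) (expR f4) (1 - expR _) I' g => {f1 f2 f3 f4}.
move=> e1 e2 e3 e4 Q I g e30 /negbT e40 Q0 g0.
by field; rewrite Q0 e30 e40 g0.
Qed.

Lemma natr_truncn_mul (z : R) N : 0 < z < 1 ->
  [/\ (Num.truncn (z * N%:R) <= N)%N, (Num.truncn (z * N%:R))%:R <= z * N%:R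
    & z * N%:R < (Num.truncn (z * N%:R))%:R + 1].
Proof.
move=> /andP[z0 z1]; have zN : 0 <= z * N%:R by rewrite mulr_ge0 // ltW.
have /andP[t1 t2] := truncn_itv zN; rewrite natr1; split=> //.
by rewrite -(ler_nat R) (le_trans t1) // ler_piMl // ltW.
Qed.

Variables (beta : R) (beta0 : 0 < beta) (x y : R) (hx : 0 < x < 1) (hy : 0 < y < 1).

(** Asymptotic standard deviation of the height, in units of $\sqrt N$. *)
Definition height_dev : R := (Num.sqrt beta * expR (d_lim beta x y))^-1.

Lemma height_dev_gt0 : 0 < height_dev.
Proof. by rewrite invr_gt0 mulr_gt0 ?sqrtr_gt0 ?expR_gt0. Qed.

(** Law of the height under the Mallows measure with $q = 1 - \beta/N$. *)
Definition mallows_height_pmf N : nat -> R :=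
  height_pmf (1 - beta / N%:R) N (Num.truncn (x * N%:R)) (Num.truncn (y * N%:R)).

Lemma mallows_gaussian_ratios :
  gaussian_ratios (h_lim beta x y) height_dev mallows_height_pmf.
Proof.
move=> T e e0; have [h0 hxl hyl h4] := h_lim_bounds beta0 hx hy.
set h := h_lim beta x y in h0 hxl hyl h4 *.
have t0 := height_dev_gt0; set tau := height_dev in t0 *.
have [/andP[x0 x1] /andP[y0 y1]] := (hx, hy).
(* seven error terms in all *)
have e'0 : 0 < e / (7 * tau) by rewrite divr_gt0 // mulr_gt0.
have wy0 : 0 < y - h by lra.
have wy1 : y - h < 1 by lra.
have wx0 : 0 < x - h by lra.
have wx1 : x - h < 1 by lra.
have h1 : h < 1 by lra.
have w1 : 1 - x - y + h < 1 by lra.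
near=> N => k kT.
have N1 : 1 <= Num.sqrt N%:R :> R by near: N; exact: near_sqrt_ge.
have rl : 2 * beta / (e / (7 * tau)) <= Num.sqrt N%:R by near: N; exact: near_sqrt_ge.
have rb : 2 * beta <= Num.sqrt N%:R by near: N; exact: near_sqrt_ge.
have [_ lE l0 lr] : mallows_rate_estimate beta N.
  by near: N; exact: near_mallows_rate.
have A1 : ln1mexp_expansion beta (y - h) (T * tau) (e / (7 * tau)) N.
  by near: N; exact: near_ln1mexp.
have A2 : ln1mexp_expansion beta (x - h) (T * tau) (e / (7 * tau)) N.
  by near: N; exact: near_ln1mexp.
have A3 : ln1mexp_expansion beta h (T * tau) (e / (7 * tau)) N.
  by near: N; exact: near_ln1mexp.
have A4 : ln1mexp_expansion beta (1 - x - y + h) (T * tau) (e / (7 * tau)) N.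
  by near: N; exact: near_ln1mexp.
rewrite /ln1mexp_expansion in A1 A2 A3 A4.
rewrite /mallows_height_pmf -lE.
have [LN L1 L2] := natr_truncn_mul N hx; have [KN K1 K2] := natr_truncn_mul N hy.
move: (Num.truncn _) LN L1 L2 (Num.truncn _) KN K1 K2 => L LN L1 L2 K KN K1 K2.
move: (mallows_rate beta N) l0 lr A1 A2 A3 A4 {lE} => l l0 lr A1 A2 A3 A4.
have eN : N%:R = Num.sqrt N%:R * Num.sqrt N%:R :> R by rewrite -expr2 sqr_sqrtr.
set r := Num.sqrt N%:R in N1 rl rb eN A1 A2 A3 A4.
have r0 : 0 < r by exact: lt_le_trans N1.
have N0 : 0 < N%:R :> R by rewrite eN mulr_gt0.
pose z : R := k%:R - h * N%:R.
have ez : rescale h tau N k = z / (tau * r) by [].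
have zT : `|z| <= T * tau * r.
  move: kT; rewrite ez normrM normfV (gtr0_norm (mulr_gt0 t0 r0)).
  by rewrite ler_pdivrMr ?mulr_gt0 // mulrA.
have zT' : `|- z| <= T * tau * r by rewrite normrN.
have m1 : `|K%:R - k%:R - ((y - h) * N%:R + - z)| <= 3.
  by move: K1 K2; rewrite ler_norml /z; clear; lra.
have m2 : `|L%:R - k%:R - ((x - h) * N%:R + - z)| <= 3.
  by move: L1 L2; rewrite ler_norml /z; clear; lra.
have m3 : `|k%:R + 1 - (h * N%:R + z)| <= 3 by rewrite ler_norml /z; clear; lra.
have m4 : `|N%:R + k%:R + 1 - L%:R - K%:R - ((1 - x - y + h) * N%:R + z)| <= 3.
  by move: K1 K2 L1 L2; rewrite ler_norml /z; clear; lra.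
have [n1 u1 f1] := A1 _ _ m1 zT'; have [n2 u2 f2] := A2 _ _ m2 zT'.
have [n3 _ f3] := A3 _ _ m3 zT; have [n4 _ f4] := A4 _ _ m4 zT.
have kK : (k < K)%N by rewrite -(ltr_nat R) -subr_gt0.
have kL : (k < L)%N by rewrite -(ltr_nat R) -subr_gt0.
have LK : (L + K <= N + k)%N.
  rewrite -ltnS -(addn1 (N + k)) -(ltr_nat R) !natrD -subr_gt0.
  suff -> : N%:R + k%:R + 1 - (L%:R + K%:R) = N%:R + k%:R + 1 - L%:R - K%:R :> R by [].
  by ring.
have P0 : 0 < height_pmf (expR (- l)) N L K k.
  have q1 : expR (- l) < 1 by rewrite expR_lt1 oppr_lt0.
  by rewrite divr_gt0 ?qfact_gt0 ?inv_gen_gt0 ?expR_gt0 // ltnW.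
split => //; rewrite height_pmf_step //.
set ell := (X in _ <= expR X * _ <= _).
(* It remains to compare logarithms of ratios. *)
suff : `|ell + rescale h tau N k * mesh tau N| <= e * mesh tau N.
  rewrite ler_norml => /andP[b1 b2].
  rewrite !ler_pM2r // !ler_expR; apply/andP; split.
    by rewrite addrC lerBlDr.
  by rewrite [leRHS]addrC lerBrDr.
have em : mesh tau N = (tau * r)^-1 by [].
pose s := beta * z / N%:R.
have es : beta * - z / N%:R = - s by rewrite mulrN mulNr.
rewrite es in u1 f1 u2 f2; rewrite -/s in f3 f4.
have bal := ln1mexp_balance beta0 hx hy; have dbal := dln1mexp_balance beta0 hx hy.
rewrite -/h in bal dbal.
have etd : rescale h tau N k * mesh tau N = expR (d_lim beta x y) ^+ 2 * s.
  have -> : expR (d_lim beta x y) ^+ 2 * s = (tau ^- 2) * z / N%:R.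
    rewrite /s /tau /height_dev -exprVn invrK exprMn sqr_sqrtr ?ltW //; ring.
  by rewrite ez em eN; field; rewrite !gt_eqF.
have ll : `|l| <= e / (7 * tau) / r.
  have b2N : 2 * beta <= N%:R by rewrite (le_trans rb) // eN ler_peMl // ltW.
  have hl : l <= 2 * beta / N%:R.
    have : 2 * beta ^+ 2 / (N%:R * N%:R) <= beta / N%:R.
      have -> : 2 * beta ^+ 2 / (N%:R * N%:R) = 2 * beta / N%:R * (beta / N%:R).
        by field; rewrite gt_eqF.
      apply: ler_piMl; first by rewrite divr_ge0 // ltW.
      by rewrite ler_pdivrMr // mul1r.
    move: lr; rewrite ler_norml => /andP[_ hi] /(le_trans hi).
    by rewrite lerBlDr -mulrA mulrDl mul1r.
  rewrite ger0_norm ?(ltW l0) // (le_trans hl) //.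
  have -> : 2 * beta / N%:R = 2 * beta / r / r by rewrite eN; field; rewrite gt_eqF.
  by rewrite ler_pM2r ?invr_gt0 // ler_pdivrMr // [leRHS]mulrC -ler_pdivrMr.
have em7 : e * mesh tau N = 7 * (e / (7 * tau) / r).
  by rewrite em; field; rewrite !gt_eqF.
rewrite em7 etd -dbal; exact: ratio_error u1 u2 f1 f2 f3 f4 ll bal.
Unshelve. all: by end_near. Qed.

End HeightRatios.

Theorem corollary4p14 (R : realType) (beta : R) (hbeta : 0 < beta)
    (x y : R) (hx : 0 < x < 1) (hy : 0 < y < 1) (a b : R) (hab : a < b) :
  mallows (1 - beta / N%:R)
    [pred w : 'S_N |
      a < ((height (Num.truncn (x * N%:R)) (Num.truncn (y * N%:R)) w)%:R
             - h_lim beta x y * N%:R) / sigma N beta x y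
        < b] @[N --> \oo]
  --> \int[lebesgue_measure]_(t in `[a, b]) normal_pdf 0 1 t.
Proof.
have [h0 hxl hyl h4] := h_lim_bounds hbeta hx hy.
have h1 : h_lim beta x y < 1 by case/andP: hx => _; apply: lt_trans.
have t0 := height_dev_gt0 hbeta x y.
have q01 : \forall N \near \oo, 0 < 1 - beta / N%:R < 1.
  by apply: filterS (near_mallows_rate hbeta) => N [].
have := @window_gauss_cvg _ _ _ (mallows_height_pmf beta x y) h0 h1 t0
  (mallows_gaussian_ratios hbeta hx hy) _ _ _ a b hab.
have ge0 : \forall N \near \oo, forall k, 0 <= mallows_height_pmf beta x y N k.
  apply: filterS q01 => N /andP[q0 q1] k.
  by rewrite divr_ge0 ?inv_gen_ge0 // ltW // qfact_gt0.
have sum1 : \forall N \near \oo, \sum_(k < N.+1) mallows_height_pmf beta x y N k = 1.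
  apply: filterS q01 => N /andP[q0 q1]; apply: sum_height_pmf1 => //.
  by have [] := natr_truncn_mul N hy.
have lc : \forall N \near \oo, forall i j m, (i <= j)%N ->
    mallows_height_pmf beta x y N i * mallows_height_pmf beta x y N (j + m)%N
      <= mallows_height_pmf beta x y N (i + m)%N * mallows_height_pmf beta x y N j.
  apply: filterS q01 => N /andP[q0 q1] i j m ij.
  have [LN _ _] := natr_truncn_mul N hx; have [KN _ _] := natr_truncn_mul N hy.
  rewrite /mallows_height_pmf /height_pmf mulrACA [leRHS]mulrACA.
  rewrite ler_pM2r ?mulr_gt0 ?invr_gt0 ?qfact_gt0 //.
  exact: inv_gen_log_concave.
move=> /(_ ge0 sum1 lc); apply: cvg_trans; apply: near_eq_cvg.
apply: filterS q01 => N /andP[q0 q1].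
have [KN _ _] := natr_truncn_mul N hy.
pose g k := a < rescale (h_lim beta x y) (height_dev beta x y) N k < b.
have ed k : (k%:R - h_lim beta x y * N%:R) / sigma N beta x y =
    rescale (h_lim beta x y) (height_dev beta x y) N k.
  by rewrite /rescale /mesh /sigma /height_dev; congr (_ * _^-1); exact: mulrC.
rewrite /window -(mallows_heightE (Num.truncn (x * N%:R)) g q0 q1 KN).
by rewrite /g; congr mallows; apply/funext => w /=; rewrite ed.
Qed.
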